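(* Fix parameters $\alpha\in(0,1/2]$, $r>1$, $\kappa:=1/r$ and $\beta\ge\frac14(1-\kappa)^{-2}$, and let $f(t):=(t\ln t)^{1/2}$ for $t\ge1$. There exists a positive constant $\gamma$ (depending only on $\alpha,r,\beta$) such that for every $n\ge1$, every $k$ with $1\le k\le n$, and every input $X$ of $n$ totally ordered elements, the expected number $C_{nk}$ of comparisons between elements made by $\textsc{Select}(X,k)$ (described in the context) satisfies $$C_{nk}\le n+\min\{k,n-k\}+\gamma f(n).$$
   Context: Selection problem: given a finite set (elements may be equal) $X=\{x_j\}_{j=1}^n$ with a total order $<$ and an integer $1\le k\le n$, find a $k$th smallest element of $X$, i.e. an $x\in X$ with at most $k-1$ elements $x_j<x$ and at least $k$ elements $x_j\le x$. Only comparisons between pairs of elements are counted; the expectation is over the algorithm's random sampling. Algorithm $\textsc{Select}(X,k)$, with fixed parameters $\alpha\in(0,1/2]$, $r>1$, $\kappa:=1/r$, $\beta\ge\frac14(1-\kappa)^{-2}$ (integer roundings of sample sizes are ignored: it is assumed $s_1:=n^\alpha$ and $s_{l+1}:=r^2s_l$ are integers and $n=r^{2\bar l}s_1$ for an integer $\bar l$). Step 1: If $n=1$ return $x_1$. Set $s_1:=n^\alpha$, $\bar l$ with $n=r^{2\bar l}s_1$, $\theta:=k/n$, $l:=1$. Step 2: Draw a uniformly random sample $S_1$ of size $s_1$ from $X$. Define $g_l:=(\beta s_l\ln n)^{1/2}$ for $l\le\bar l$, $g_{\bar l+1}:=0$, and $i_u^l:=\max\{\lceil\theta s_l-g_l\rceil,1\}$,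 $i_v^l:=\min\{\lceil\theta s_l+g_l\rceil,s_l\}$. Compute recursively $u_1:=\textsc{Select}(S_1,i_u^1)$, $v_1:=\textsc{Select}(S_1,i_v^1)$. Step 3: Draw $S_{l+1}\supset S_l$ of size $s_{l+1}:=r^2s_l$ by adding $s_{l+1}-s_l$ uniformly random elements of $X\setminus S_l$. Step 4: With $u:=u_l$, $v:=v_l$, compare each $x\in S_{l+1}\setminus S_l$ with $u$ and $v$ (the positions of elements of $S_l$ relative to $u,v$ are already known) to partition $S_{l+1}$ into $L=\{x<u\}$, $U=\{x=u\}$, $M=\{u<x<v\}$, $V=\{x=v\}$, $R=\{v<x\}$. If $\theta<1/2$, $x$ is compared with $v$ first and with $u$ only if $x<v$; if $\theta\ge1/2$ the order is reversed. Step 5: Let $i_u^+:=i_u^{l+1}$, $i_v^+:=i_v^{l+1}$. If $|L|<i_u^+\le|L\cup U|$ set $u_{l+1}:=u$; else if $|L\cup U\cup M|<i_u^+\le s_{l+1}-|R|$ set $u_{l+1}:=v$; else set $u_{l+1}:=\textsc{Select}(\hat S_u,\hat\imath_u^+)$ where: if $i_u^+\le|L|$, $\hat S_u:=L$, $\hat\imath_u^+:=i_u^+$; if $s_{l+1}-|R|<i_u^+$, $\hat S_u:=R$, $\hat\imath_u^+:=i_u^+-s_{l+1}+|R|$; otherwise $\hat S_u:=M$, $\hat\imath_u^+:=i_u^+-|L\cup U|$. Find $v_{l+1}$ (and possibly $\hat S_v,\hat\imath_v^+$) in the same way with $i_v^+$ in place of $i_u^+$. Step 6: If $s_{l+1}=n$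 return $u_{l+1}$; otherwise increase $l$ by 1 and go to Step 3. *)

(* Defs.v *)
From mathcomp Require Import all_boot all_order all_algebra reals exp.

Set Implicit Arguments.
Unset Strict Implicit.
Unset Printing Implicit Defensive.

Import Order.TTheory GRing.Theory Num.Theory.
Local Open Scope ring_scope.

Section Computation.
Variable R : realType.

(* A randomized computation is its finite list of outcomes; each outcome is a
   triple (probability, number of comparisons made, returned value).  Different
   entries may carry the same value: their probabilities add up. *)
Definition rcomp (A : Type) : Type := seq (R * nat * A).

Definition ret A (a : A) : rcomp A := [:: (1, 0%N, a)].

Definition bind A B (m : rcomp A) (f : A -> rcomp B) : rcomp B :=
  [seq (p.1.1 * q.1.1, (p.1.2 + q.1.2)%N, q.2) | p <- m, q <- f p.2].

Definition compare (c : nat) : rcomp unit := [:: (1, c, tt)].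

Definition draw (A : finType) (F : {set A}) : rcomp A :=
  [seq (#|F|%:R^-1, 0%N, a) | a <- enum F].

(* The probability of getting here is lost. *)
Definition abort A : rcomp A := [::].

Definition total_prob A (m : rcomp A) : R := \sum_(p <- m) p.1.1.

Definition expected_comparisons A (m : rcomp A) : R :=
  \sum_(p <- m) p.1.1 * p.1.2%:R.

End Computation.

Notation "x <~ m ;; e" := (bind m (fun x => e))
  (at level 100, m at level 99, e at level 200, right associativity).

Section Select.
Variables (R : realType) (alpha r beta : R).
(* The input is an indexed family, so that equal elements may occur; its
   subfamilies are the sets of their indices. *)
Variables (I : finType) (d : Order.disp_t) (T : orderType d) (x : I -> T).

(* The sample sizes s_1 = n^alpha and s_(l+1) = r^2 s_l must be integers and
   have to reach n exactly.  We round s_1 down, so that 1 <= s_1 < n for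
   n >= 2, and r^2 s_l up, truncating at n, so that s_l < s_(l+1) <= n as long
   as s_l < n.  Nothing is rounded when n^alpha and all the r^2 s_l are integers
   and n = r^(2 lbar) s_1 for some integer lbar. *)
Definition first_size (n : nat) : nat := Num.truncn (n%:R `^ alpha).
Definition next_size (n s : nat) : nat :=
  minn `|Num.ceil (r ^+ 2 * s%:R)| n.

(* g_l = sqrt (beta s_l ln n) for l <= lbar and g_(lbar + 1) = 0, where lbar + 1
   is the only l such that s_l = n. *)
Definition gap (n s : nat) : R :=
  if s == n then 0 else Num.sqrt (beta * s%:R * ln n%:R).

Definition theta (n k : nat) : R := k%:R / n%:R.

Definition lower_rank (n k s : nat) : nat :=
  `|Num.max (Num.ceil (theta n k * s%:R - gap n s)) 1|.
Definition upper_rank (n k s : nat) : nat :=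
  `|Num.min (Num.ceil (theta n k * s%:R + gap n s)) s%:Z|.

(* A comparison is three-way.  If th < 1/2 the element is compared with v first,
   and with u only if it is smaller than v; otherwise it is compared with u
   first, and with v only if it is larger than u. *)
Definition locate_cost (th : R) (u v j : I) : nat :=
  if th < 2^-1 then (if (x j < x v)%O then 2 else 1)
  else (if (x u < x j)%O then 2 else 1).

Section Body.
(* The recursive calls of the algorithm. *)
Variable rec : {set I} -> nat -> rcomp R I.

(* The element of rank i of S, given the position of all of S relative to the
   pivots u and v; no comparison is made outside the recursive call. *)
Definition update (S : {set I}) (u v : I) (i : nat) : rcomp R I :=
  let L := [set j in S | (x j < x u)%O] in
  let U := [set j in S | x j == x u] in
  let M := [set j in S | (x u < x j < x v)%O] in
  let Rt := [set j in S | (x v < x j)%O] in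
  if (#|L| < i <= #|L :|: U|)%N then ret R u
  else if (#|L :|: U :|: M| < i <= #|S| - #|Rt|)%N then ret R v
  else if (i <= #|L|)%N then rec L i
  else if (#|S| - #|Rt| < i)%N then rec Rt (i + #|Rt| - #|S|)%N
  else rec M (i - #|L :|: U|)%N.

(* S, u and v are the current sample S_l and its pivots u_l, v_l.  Only the
   elements of S' :\: S are compared with the pivots, the positions of those of
   S being known from the computation of the pivots.  Both pivots are updated
   in every round, including the last one. *)
Fixpoint rounds (fuel : nat) (A : {set I}) (k : nat)
    (S : {set I}) (u v : I) : rcomp R I :=
  if fuel is fuel'.+1 then
    let n := #|A| in
    S' <~ draw R [set S' : {set I} | [&& S \subset S', S' \subset A &
                                      #|S'| == next_size n #|S|]] ;;
    _ <~ compare R (\sum_(j in S' :\: S) locate_cost (theta n k) u v j)%N ;;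
    u' <~ update S' u v (lower_rank n k #|S'|) ;;
    v' <~ update S' u v (upper_rank n k #|S'|) ;;
    if #|S'| == n then ret R u' else rounds fuel' A k S' u' v'
  else abort R I.

Definition select_body (A : {set I}) (k : nat) : rcomp R I :=
  if enum A is [:: j] then ret R j
  else
    let n := #|A| in
    S <~ draw R [set S : {set I} | (S \subset A) && (#|S| == first_size n)] ;;
    u <~ rec S (lower_rank n k #|S|) ;;
    v <~ rec S (upper_rank n k #|S|) ;;
    rounds n A k S u v.

End Body.

(* Recursive calls are made on proper subfamilies and every round enlarges the
   sample, so that the fuel is never exhausted, neither here nor in [rounds]:
   by [select_correct] no probability is lost. *)
Fixpoint select_fuel (fuel : nat) (A : {set I}) (k : nat) : rcomp R I :=
  if fuel is fuel'.+1 then select_body (select_fuel fuel') A k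
  else abort R I.

Definition select (A : {set I}) (k : nat) : rcomp R I := select_fuel #|A| A k.

Definition kth_smallest (A : {set I}) (k : nat) (j : I) : bool :=
  [&& j \in A, (#|[set i in A | (x i < x j)%O]| <= k.-1)%N
    & (k <= #|[set i in A | (x i <= x j)%O]|)%N].

End Select.

Definition f (R : realType) (t : R) : R := Num.sqrt (t * ln t).

Section Adequacy.
Variable R : realType.

Definition surely A (P : pred A) (m : rcomp R A) : Prop :=
  total_prob m = 1 /\ all (fun p => P p.2) m.

Lemma sub_surely A (P Q : pred A) m :
  (forall a, P a -> Q a) -> surely P m -> surely Q m.
Proof. by move=> PQ [m1 mP]; split=> //; apply: sub_all mP => p; apply: PQ. Qed.

Lemma surely_ret A (P : pred A) a : P a -> surely P (ret R a).
Proof. by move=> Pa; split; [rewrite /total_prob big_seq1 | rewrite /= Pa]. Qed.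

Lemma surely_bind A B (P : pred A) (Q : pred B) m (g : A -> rcomp R B) :
  surely P m -> (forall a, P a -> surely Q (g a)) -> surely Q (bind m g).
Proof.
move=> [m1 mP] gQ; split.
  rewrite /total_prob big_allpairs_dep /= -m1 /total_prob.
  elim: m mP {m1} => [|p m IHm]; first by rewrite !big_nil.
  move=> /= /andP[Pp mP]; rewrite !big_cons IHm //; congr (_ + _); rewrite -mulr_sumr.
  by rewrite -/(total_prob _) (gQ _ Pp).1 mulr1.
elim: m mP {m1} => //= p m IHm /andP[Pp mP].
by rewrite /bind allpairs_cons all_cat IHm // andbT all_map; exact: (gQ _ Pp).2.
Qed.

Lemma surely_compare c : surely xpredT (compare R c).
Proof. by split; rewrite /total_prob ?big_seq1. Qed.

Lemma surely_draw (A : finType) (F : {set A}) :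
  F != set0 -> surely [in F] (draw R F).
Proof.
rewrite -card_gt0 => F0; split; last first.
  by rewrite all_map; apply/allP => a; rewrite mem_enum.
rewrite /total_prob big_map /= big_enum /= sumr_const -[_ *+ _]mulr_natr.
by rewrite mulVf // pnatr_eq0 -lt0n.
Qed.

Section KthSmallest.
Variables (I : finType) (d : Order.disp_t) (T : orderType d) (x : I -> T).
Implicit Types (A B S : {set I}).

Lemma kth_smallest_le S i j u v : (i <= j)%N ->
  kth_smallest x S i u -> kth_smallest x S j v -> (x u <= x v)%O.
Proof.
move=> ij /and3P[uS ui iu] /and3P[vS vj jv]; rewrite leNgt; apply/negP => vu.
have i0 : (0 < i)%N.
  rewrite lt0n; apply/eqP => i0; move: ui; rewrite i0 leqn0 cards_eq0.
  by move/eqP/setP/(_ v); rewrite !inE vS vu.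
have : (#|[set l in S | (x l <= x v)%O]| <= #|[set l in S | (x l < x u)%O]|)%N.
  apply/subset_leq_card/subsetP => l; rewrite !inE => /andP[-> lv] /=.
  exact: le_lt_trans vu.
move=> vu'; have := leq_trans jv (leq_trans vu' ui).
by case: i {ui iu vu'} i0 ij => // i _ /= ij /(leq_trans ij); rewrite ltnn.
Qed.

Lemma kth_smallest_sub S A B k w : B \subset S -> A \subset S ->
    (forall a b, a \in A -> b \in B -> (x a < x b)%O) ->
    (forall a b, a \in S -> a \notin A -> a \notin B -> b \in B -> (x b < x a)%O) ->
  (0 < k)%N -> kth_smallest x B k w -> kth_smallest x S (k + #|A|) w.
Proof.
move=> /subsetP BS /subsetP AS AB BSA k0 /and3P[wB wk kw].
have dAB (P : pred I) : [disjoint A & [set l in B | P l]].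
  rewrite disjoint_subset; apply/subsetP => a aA; rewrite !inE.
  by apply/negP => /andP[aB _]; have := AB a a aA aB; rewrite ltxx.
have E1 : [set l in S | (x l < x w)%O] = A :|: [set l in B | (x l < x w)%O].
  apply/setP => l; rewrite !inE; case lA: (l \in A) => /=.
    by rewrite AS // AB.
  case lB: (l \in B) => /=; first by rewrite BS.
  case lS: (l \in S) => //=; apply: lt_gtF.
  by apply: BSA => //; rewrite ?lA ?lB.
have E2 : [set l in S | (x l <= x w)%O] = A :|: [set l in B | (x l <= x w)%O].
  apply/setP => l; rewrite !inE; case lA: (l \in A) => /=.
    by rewrite AS // ltW // AB.
  case lB: (l \in B) => /=; first by rewrite BS.
  case lS: (l \in S) => //=; apply: lt_geF.
  by apply: BSA => //; rewrite ?lA ?lB.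
have cU P : #|A :|: [set l in B | P l]| = (#|A| + #|[set l in B | P l]|)%N.
  by apply/eqP; rewrite (leq_card_setU _ _).2.
apply/and3P; split; first exact: BS.
  by rewrite E1 cU -subn1 addnC -addnBAC // subn1 leq_add2r.
by rewrite E2 cU addnC leq_add2l.
Qed.

Variables (rec : {set I} -> nat -> rcomp R I).

Lemma update_correct (S : {set I}) u v i :
    u \in S -> v \in S -> (x u <= x v)%O -> (0 < i <= #|S|)%N ->
    (forall B j, B \proper S -> (0 < j <= #|B|)%N ->
       surely (kth_smallest x B j) (rec B j)) ->
  surely (kth_smallest x S i) (update x rec S u v i).
Proof.
move=> uS vS uv /andP[i0 iS] recP; rewrite /update.
set L := [set j in S | (x j < x u)%O]; set U := [set j in S | x j == x u].
set M := [set j in S | _ && _]; set V := [set j in S | (x v < x j)%O].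
have VS : V \subset S by apply/subsetP => j; rewrite inE => /andP[].
have cV : (#|S| - #|V|)%N = #|[set j in S | (x j <= x v)%O]|.
  rewrite -cardsDS //; congr #|pred_of_set _|.
  by apply/setP => j; rewrite !inE; case: (j \in S) => //=; rewrite ?andbT ?andbF // leNgt.
have LU : L :|: U = [set j in S | (x j <= x u)%O].
  by apply/setP => j; rewrite !inE le_eqVlt; case: (j \in S) => //=; rewrite orbC.
have prop (B : {set I}) w : w \in S -> w \notin B -> B \subset S -> B \proper S.
  by move=> wS wB BS; apply/properP; split => //; exists w.
case: ifPn => [/andP[Li iLU]|NU].
  apply: surely_ret; apply/and3P; split=> //; last by rewrite -LU.
  by rewrite -/L -ltnS prednK.
case: ifPn => [/andP[Mi iV]|NV].
  apply: surely_ret; apply/and3P; split=> //; last by rewrite -cV.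
  rewrite -ltnS prednK //; apply: leq_ltn_trans Mi; apply: subset_leq_card.
  apply/subsetP => j; rewrite !inE => /andP[-> jv] /=; rewrite jv.
  by case: ltgtP.
case: ifPn => [iL|iL].
  have LS : L \subset S by apply/subsetP => j; rewrite inE => /andP[].
  apply: (sub_surely _ (recP L i _ _)); rewrite ?i0 //; last first.
    by apply: (prop _ u); rewrite // inE ltxx andbF.
  move=> w wL; rewrite -[i]addn0 -(cards0 I).
  apply: (kth_smallest_sub LS) wL => //; rewrite ?sub0set //.
    by move=> a b; rewrite inE.
  move=> a b aS _; rewrite !inE aS /= -leNgt => ua /andP[_ bu].
  exact: lt_le_trans ua.
case: ifPn => [iV|iV].
  have DS : S :\: V \subset S by exact: subsetDl.
  have cD : #|S :\: V| = (#|S| - #|V|)%N by rewrite cardsDS.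
  have le_VS := subset_leq_card VS.
  have iE : (i + #|V| - #|S| + #|S :\: V| = i)%N.
    by rewrite cD -subnBA // subnK // ltnW.
  apply: (sub_surely _ (recP V _ _ _)); last first.
  - rewrite subn_gt0 leq_subLR leq_add2r iS andbT.
    by rewrite addnC -ltn_subLR.
  - by apply: (prop _ v); rewrite // inE ltxx andbF.
  move=> w wV; rewrite -iE.
  apply: (kth_smallest_sub VS DS) wV => //.
  - move=> a b; rewrite !inE => /andP[+ aS] /andP[_ vb]; rewrite aS /= -leNgt => av.
    exact: le_lt_trans vb.
  - by move=> a b aS; rewrite !inE aS /= andbT negbK => ->.
  - by rewrite subn_gt0 addnC -ltn_subLR.
have MS : M \subset S by apply/subsetP => j; rewrite inE => /andP[].
have LUS : L :|: U \subset S by apply/subsetP => j; rewrite LU inE => /andP[].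
have LUi : (#|L :|: U| < i)%N.
  by rewrite -ltnNge in iL; rewrite iL /= -ltnNge in NU.
have iM : (i <= #|L :|: U :|: M|)%N.
  by rewrite -leqNgt in iV; rewrite iV andbT -leqNgt in NV.
apply: (sub_surely _ (recP M _ _ _)); last first.
- rewrite subn_gt0 LUi leq_subLR; apply: leq_trans iM _.
  exact: (leq_card_setU _ _).1.
- by apply: (prop _ u); rewrite // inE ltxx andbF.
move=> w wM; rewrite -(subnK (ltnW LUi)).
apply: (kth_smallest_sub MS LUS) wM => //; last by rewrite subn_gt0.
  move=> a b; rewrite LU !inE => /andP[_ au] /and3P[_ ub _].
  exact: le_lt_trans ub.
move=> a b aS; rewrite LU !inE aS /= -ltNge => ua; rewrite ua /= -leNgt => va.
by move=> /and3P[_ _ bv]; exact: lt_le_trans va.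
Qed.

Variables (alpha r beta : R).

Lemma first_size_exact n s : n%:R `^ alpha = s%:R -> first_size alpha n = s.
Proof. by rewrite /first_size => ->; exact: natrK. Qed.

Lemma next_size_exact n s s' : (s' <= n)%N -> r ^+ 2 * s%:R = s'%:R ->
  next_size r n s = s'.
Proof. by rewrite /next_size => s'n ->; rewrite pmulrn intrKceil; exact/minn_idPl. Qed.

Lemma first_size_bounds n : 0 < alpha <= 1 / 2 -> (1 < n)%N ->
  (0 < first_size alpha n < n)%N.
Proof.
move=> /andP[a0 a1] n1; have n1R : 1 < n%:R :> R by rewrite ltr1n.
have n0R : 0 <= n%:R :> R by [].
rewrite truncn_gt0 -[X in X <= _](powRr0 n%:R) ler_powR ?(ltW n1R) ?(ltW a0) //=.
have n0 : 0 < n%:R :> R by exact: lt_trans n1R.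
rewrite truncn_lt_nat ?powR_ge0 // /powR gt_eqF // -[X in _ < X]lnK ?posrE //.
rewrite ltr_expR gtr_pMl ?ln_gt0 //; apply: (le_lt_trans a1).
by rewrite mul1r invf_lt1 ?ltr1n ?ltr0n.
Qed.

Lemma next_size_bounds n s : 1 < r -> (0 < s < n)%N ->
  (s < next_size r n s <= n)%N.
Proof.
move=> r1 /andP[s0 sn]; rewrite geq_minr andbT leq_min sn andbT.
have : s%:Z < Num.ceil (r ^+ 2 * s%:R).
  rewrite ceil_gt_int -pmulrn ltr_pMl ?ltr0n //.
  by rewrite exprn_egt1.
by move=> h; rewrite -ltz_nat gez0_abs //; apply: le_trans (ltW h).
Qed.

Lemma rank_bounds n k s : (0 < k <= n)%N -> (0 < s)%N ->
  [/\ (0 < lower_rank beta n k s)%N,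
      (lower_rank beta n k s <= upper_rank beta n k s)%N &
      (upper_rank beta n k s <= s)%N].
Proof.
move=> /andP[k0 kn] s0; rewrite /lower_rank /upper_rank.
have n0 : (0 < n)%N by apply: leq_trans kn.
set t := theta R n k; set g := gap beta n s.
have g0 : 0 <= g by rewrite /g /gap; case: ifP => // _; exact: sqrtr_ge0.
have t0 : 0 < t by rewrite divr_gt0 ?ltr0n.
have t1 : t <= 1 by rewrite ler_pdivrMr ?ltr0n // mul1r ler_nat.
have sR : 0 < s%:R :> R by rewrite ltr0n.
have lo : 1 <= Num.max (Num.ceil (t * s%:R - g)) 1 by rewrite le_max lexx orbT.
have hc : 1 <= Num.ceil (t * s%:R + g).
  by rewrite -gtz0_ge1 ceil_gt0 ltr_wpDr // mulr_gt0.
have hi : 1 <= Num.min (Num.ceil (t * s%:R + g)) s%:Z by rewrite le_min hc.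
have lh : Num.max (Num.ceil (t * s%:R - g)) 1 <= Num.min (Num.ceil (t * s%:R + g)) s%:Z.
  rewrite ge_max hi andbT le_min; apply/andP; split.
    by apply: le_ceil; rewrite lerD2l (le_trans _ g0) // oppr_le0.
  rewrite ceil_le_int -pmulrn lerBlDr; apply: le_trans (_ : s%:R <= _).
    by rewrite ler_piMl // ltW.
  by rewrite lerDl.
have lo0 := le_trans ler01 lo; have hi0 := le_trans ler01 hi.
split.
- by rewrite -ltz_nat gez0_abs // (lt_le_trans _ lo).
- by rewrite -lez_nat !gez0_abs.
- by rewrite -lez_nat gez0_abs // ge_min lexx orbT.
Qed.

Lemma lower_rank_last n k : (0 < k)%N -> (0 < n)%N -> lower_rank beta n k n = k.
Proof.
move=> k0 n0; rewrite /lower_rank /gap eqxx subr0 /theta divfK ?pnatr_eq0 -?lt0n //.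
by rewrite pmulrn intrKceil (max_idPl _) // lez_nat.
Qed.

Lemma rounds_correct fuel (A S : {set I}) k u v :
    1 < r -> (0 < k <= #|A|)%N -> S \subset A -> (0 < #|S| < #|A|)%N ->
    (#|A| <= fuel + #|S|)%N ->
    kth_smallest x S (lower_rank beta #|A| k #|S|) u ->
    kth_smallest x S (upper_rank beta #|A| k #|S|) v ->
    (forall B j, B \proper A -> (0 < j <= #|B|)%N ->
       surely (kth_smallest x B j) (rec B j)) ->
  surely (kth_smallest x A k) (rounds r beta x rec fuel A k S u v).
Proof.
move=> r1 kA + + + + + recP; have /andP[k0 kn] := kA.
elim: fuel S u v => [|fuel IH] S u v SA /andP[S0 SltA] Af uk vk /=.
  by rewrite leqNgt SltA in Af.
have /andP[lt_next le_next] := next_size_bounds r1 (introT andP (conj S0 SltA)).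
apply: (surely_bind (P := fun S' : {set I} => [&& S \subset S', S' \subset A &
                                      #|S'| == next_size r #|A| #|S|])).
  apply: (sub_surely _ (surely_draw _)) => [S'|]; first by rewrite inE.
  have : (0 < #|[set B : {set I} | B \subset A :\: S &
                 #|B| == (next_size r #|A| #|S| - #|S|)%N]|)%N.
    by rewrite cards_draws bin_gt0 cardsDS // leq_sub2r.
  rewrite card_gt0 => /set0Pn[B]; rewrite inE => /andP[BAS /eqP cB].
  have dSB : [disjoint S & B].
    rewrite disjoint_sym disjoint_subset; apply/subsetP => i /(subsetP BAS).
    by rewrite !inE => /andP[].
  apply/set0Pn; exists (S :|: B); rewrite inE subsetUl subUset SA /=.
  rewrite (subset_trans BAS (subsetDl _ _)) /= (eqTleqif (leq_card_setU _ _) dSB).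
  by rewrite cB subnKC // ltnW.
move=> S' /and3P[SS' S'A /eqP cS']; apply: (surely_bind (surely_compare _)) => _ _.
have S'0 : (0 < #|S'|)%N by rewrite cS' (leq_trans _ lt_next).
have [lo lh hi] := rank_bounds kA S'0.
have [lo' lh' hi'] := rank_bounds kA S0.
have uS : u \in S' by apply: (subsetP SS'); case/and3P: uk.
have vS : v \in S' by apply: (subsetP SS'); case/and3P: vk.
have uv : (x u <= x v)%O by exact: kth_smallest_le lh' uk vk.
have recS (B : {set I}) j : B \proper S' -> (0 < j <= #|B|)%N ->
    surely (kth_smallest x B j) (rec B j).
  by move=> BS'; apply: recP; exact: proper_sub_trans S'A.
apply: surely_bind (update_correct uS vS uv _ recS) _ => [|u' u'k].
  by rewrite lo (leq_trans lh).
apply: surely_bind (update_correct uS vS uv _ recS) _ => [|v' v'k].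
  by rewrite hi (leq_trans lo).
case: ifPn => [/eqP S'n|S'n].
  apply: surely_ret; move: u'k; rewrite S'n lower_rank_last //; last first.
    exact: leq_trans kn.
  by have/eqP -> : S' == A by rewrite eqEcard S'A S'n /=.
apply: IH => //; first by rewrite S'0 ltn_neqAle S'n subset_leq_card.
by apply: leq_trans Af _; rewrite addSnnS leq_add2l cS'.
Qed.

End KthSmallest.

Theorem select_correct (alpha r beta : R) (I : finType) (d : Order.disp_t)
    (T : orderType d) (x : I -> T) (A : {set I}) (k : nat) :
    0 < alpha <= 1 / 2 -> 1 < r -> (0 < k <= #|A|)%N ->
  surely (kth_smallest x A k) (select alpha r beta x A k).
Proof.
move=> a01 r1; rewrite /select.
suff H m : (#|A| <= m)%N -> (0 < k <= #|A|)%N ->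
    surely (kth_smallest x A k) (select_fuel alpha r beta x m A k) by exact: H.
elim: m A k => [|m IH] A k Am kA.
  by case/andP: kA => /leq_trans h /h; rewrite ltnNge Am.
rewrite /= /select_body.
have recP (B : {set I}) j : B \proper A -> (0 < j <= #|B|)%N ->
    surely (kth_smallest x B j) (select_fuel alpha r beta x m B j).
  by move=> BA; apply: IH; rewrite -ltnS (leq_trans (proper_card BA)).
have : (1 < #|A|)%N -> surely (kth_smallest x A k)
   (S <~ draw R [set S : {set I} | (S \subset A) && (#|S| == first_size alpha #|A|)] ;;
    u <~ select_fuel alpha r beta x m S (lower_rank beta #|A| k #|S|) ;;
    v <~ select_fuel alpha r beta x m S (upper_rank beta #|A| k #|S|) ;;
    rounds r beta x (select_fuel alpha r beta x m) #|A| A k S u v).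
  move=> A1; have /andP[s0 sA] := first_size_bounds a01 A1.
  apply: (surely_bind (P := fun S : {set I} => (S \subset A) &&
                              (#|S| == first_size alpha #|A|))).
    apply: (sub_surely _ (surely_draw _)) => [S'|]; first by rewrite inE.
    rewrite -card_gt0 cards_draws bin_gt0; exact: ltnW.
  move=> S /andP[SA /eqP cS]; rewrite -cS in s0 sA.
  have pS : S \proper A by rewrite properEcard SA.
  have [lo lh hi] := rank_bounds beta kA s0.
  apply: surely_bind (recP _ _ pS _) _ => [|u uk]; first by rewrite lo (leq_trans lh).
  apply: surely_bind (recP _ _ pS _) _ => [|v vk]; first by rewrite hi (leq_trans lo).
  by apply: rounds_correct; rewrite ?s0 ?leq_addr.
case eA: (enum A) => [|j [|j' t]].
- by case/andP: kA => /leq_trans h /h; rewrite cardE eA.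
- move=> _; have jA : A = [set j] by apply/setP => i; rewrite -mem_enum eA !inE.
  apply: surely_ret; rewrite jA cards1 in kA *.
  have -> : k = 1%N by case: k kA {eA} => [|[]].
  apply/and3P; split; first by rewrite inE.
    rewrite leqn0 cards_eq0; apply/eqP/setP => i; rewrite !inE.
    by case: eqP => //= ->; rewrite ltxx.
  by rewrite card_gt0; apply/set0Pn; exists j; rewrite !inE eqxx lexx.
- by apply; rewrite cardE eA.
Qed.
End Adequacy.

(* Main.v *)
Require Import Defs.
From mathcomp Require Import all_boot all_order all_algebra reals exp.
From mathcomp Require Import normedtype sequences derive ring lra zify.
Set Implicit Arguments.
Unset Strict Implicit.
Unset Printing Implicit Defensive.
Import Order.TTheory GRing.Theory Num.Theory.
Import numFieldNormedType.Exports.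
Local Open Scope ring_scope.

(* Let u_l be the pivot of rank i in the sample S_l of size s.  An element j is
   smaller than u_l iff fewer than i elements of S_l are at most j, so the cost of
   a round is a function of the pair (S_l, S_(l+1)) alone; and since S_l is a
   uniform subset of S_(l+1), that cost can be averaged over S_l with S_(l+1)
   fixed.

   The elements j of S_(l+1) outside S_l that lie between two ranks a <= b of S_l
   are easy to count: the union of S_l and j is an (s+1)-subset of S_(l+1), and in
   each such subset at most b - a elements have the ranks that j must have.  This bounds the
   comparisons with the second pivot, whose sum is about min(k, n - k), the size of
   M, and the sizes of L and R when the pivots are extreme elements of S_l.
   Otherwise L or R is searched only if a hypergeometric count deviates from its
   mean by more than (1 - 1/r) g_l; by Hoeffding's inequality for sampling without
   replacement and the choice of beta this has probability at most n^(-1/2).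

   Hence, if recursive calls on m elements cost at most a m, the total cost is at
   most n + min(k, n - k) + (C1 + a C2) f(n), because the errors sqrt(s_l ln n)
   form a geometric sum.  As f(n) = o(n), induction on n gives such an a, and the
   same bound then yields the theorem. *)

(** * Hoeffding's inequality for sampling without replacement *)

Section Hoeffding.
Variable R : realType.

Lemma nondecreasing_from0 (F dF : R -> R) l :
  (forall t, is_derive t (1 : R) F (dF t)) -> (forall t, 0 <= t -> 0 <= dF t) ->
  0 <= l -> F 0 <= F l.
Proof.
move=> FdF dF0 l0.
have [|c c0l FE] := MVT_segment l0 (fun t _ => FdF t).
  apply: derivable_within_continuous => t _; exact: ex_derive.
rewrite -subr_ge0 FE subr0 mulr_ge0 // dF0 //.
by move: c0l; rewrite in_itv => /andP[].
Qed.

(** [D] is the moment generating function of a Bernoulli variable, and its logarithmic derivative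
    [q] satisfies [q' = q (1 - q) <= 1/4]. Integrating twice gives [ln (D l) <= l p + l^2 / 8]. *)
Lemma hoeffding_two_point (p l : R) : 0 <= p <= 1 -> 0 <= l ->
  1 - p + p * expR l <= expR (l * p + l ^+ 2 / 8).
Proof.
move=> /andP[p0 p1] l0.
pose D t := 1 - p + p * expR t.
have D0 t : 0 < D t.
  rewrite /D; have := expR_gt0 t; have := p0; rewrite le_eqVlt => /orP[/eqP<-|].
    by rewrite subr0 mul0r addr0.
  move=> p0' e0; apply: ltr_wpDl; first by rewrite subr_ge0.
  exact: mulr_gt0.
have dD t : is_derive t (1 : R) D (p * expR t).
  rewrite /D; apply: is_derive_eq; rewrite /GRing.scale /=; ring.
pose q t := p * expR t / D t.
have q_le t : 0 <= t -> q t <= p + t / 4.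
  move=> t0; rewrite -subr_ge0.
  have -> : 0 = p + 0 / 4 - q 0.
    by rewrite /q /D expR0 mulr1 subrK divr1 mul0r addr0 subrr.
  apply: (@nondecreasing_from0 (fun t => p + t / 4 - q t)
           (fun t => 4^-1 - p * expR t * (1 - p) / D t ^+ 2)) => //.
    move=> y; rewrite /q.
    have := lt0r_neq0 (D0 y) => Dy.
    apply: is_derive_eq.
    rewrite /GRing.scale /=; rewrite /D in Dy *; field.
    done.
  move=> y _; rewrite subr_ge0 ler_pdivrMr ?exprn_gt0 //.
  (* Nonnegativity of this square is [4 p (1 - p) exp y <= D y ^ 2], that is, [q' <= 1/4]. *)
  rewrite /D; have := sqr_ge0 (1 - p - p * expR y); nra.
rewrite -(ler_pM2l (expR_gt0 (- (l * p + l ^+ 2 / 8)))).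
rewrite -[X in _ <= X]expRD addNr expR0 -subr_ge0.
(* [F] vanishes at 0, and its derivative has the sign of [p + t / 4 - q t]. *)
pose F t := 1 - expR (- (t * p + t ^+ 2 / 8)) * D t.
have -> : 0 = F 0.
  by rewrite /F /D expr0n /= !mul0r addr0 oppr0 expR0 mulr1 subrK mul1r subrr.
apply: (@nondecreasing_from0 F (fun t => expR (- (t * p + t ^+ 2 / 8)) * D t
   * (p + t / 4 - q t))) => //.
  move=> y; rewrite /F.
  have := lt0r_neq0 (D0 y) => Dy.
  apply: is_derive_eq.
  rewrite /GRing.scale /= /q; rewrite /D in Dy *; field.
  done.
move=> y y0; rewrite mulr_ge0 ?subr_ge0 ?q_le // mulr_ge0 ?expR_ge0 ?ltW //.
Qed.

End Hoeffding.

(** * Averages over uniform samples *)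

Section Sampling.
Variable R : realType.

Definition avg (X : finType) (F : {set X}) (phi : X -> R) : R :=
  #|F|%:R^-1 * \sum_(a in F) phi a.

Section Avg.
Variable X : finType.
Implicit Types (F : {set X}) (phi psi : X -> R).

Lemma eq_avg F phi psi : {in F, phi =1 psi} -> avg F phi = avg F psi.
Proof. by move=> e; congr (_ * _); apply: eq_bigr. Qed.

Lemma le_avg F phi psi : (forall a, a \in F -> phi a <= psi a) ->
  avg F phi <= avg F psi.
Proof. by move=> e; apply: ler_wpM2l; rewrite ?invr_ge0 //; exact: ler_sum. Qed.

Lemma avg_const F c : F != set0 -> avg F (fun=> c) = c.
Proof.
rewrite -card_gt0 => F0; rewrite /avg sumr_const -[c *+ _]mulr_natl mulrA mulVf
  ?mul1r //.
by rewrite pnatr_eq0 -lt0n.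
Qed.

Lemma avgD F phi psi : avg F (fun a => phi a + psi a) = avg F phi + avg F psi.
Proof. by rewrite /avg big_split mulrDr. Qed.

Lemma avgZ F c phi : avg F (fun a => c * phi a) = c * avg F phi.
Proof. by rewrite /avg -mulr_sumr mulrCA. Qed.

End Avg.

Variable I : finType.
Implicit Types (A S Q D : {set I}).

Definition draws A s := [set S : {set I} | (S \subset A) && (#|S| == s)].

Definition extensions S A m :=
  [set S' : {set I} | [&& S \subset S', S' \subset A & #|S'| == m]].

Lemma draws_neq0 A s : (s <= #|A|)%N -> draws A s != set0.
Proof. by move=> sA; rewrite -card_gt0 cards_draws bin_gt0. Qed.

(** Pairs of an (s+1)-set and one of its elements correspond to pairs of an s-set and an element
    outside it. *)
Lemma sum_draws_insert A s (G : {set I} -> I -> R) :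
  \sum_(Q in draws A s.+1) \sum_(j in Q) G Q j =
  \sum_(S in draws A s) \sum_(j in A :\: S) G (j |: S) j.
Proof.
rewrite !pair_big_dep /=.
rewrite (reindex_onto (fun p => (p.2 |: p.1, p.2)) (fun p => (p.1 :\ p.2, p.2))) /=.
  apply: eq_bigl => -[S j] /=; rewrite !inE eqxx /= andbT xpair_eqE eqxx andbT.
  have [jS|jS] := boolP (j \in S).
    rewrite andbF /= [_ == S](_ : _ = false) ?andbF //.
    by apply/eqP => /setP/(_ j); rewrite jS !inE eqxx.
  rewrite setU1K // eqxx andbT cardsU1 jS /= add1n eqSS subUset sub1set.
  by rewrite andbC andbA andbC; case: (S \subset A); case: (j \in A); case: (_ == _).
by move=> [Q j] /= /andP[_ jQ]; rewrite setD1K.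
Qed.

Lemma sum_draws_first A s (G : {set I} -> I -> R) :
  \sum_(Q in draws A s.+1) \sum_(j in Q) G Q j =
  \sum_(j in A) \sum_(S in draws (A :\ j) s) G (j |: S) j.
Proof.
rewrite sum_draws_insert (exchange_big_dep [in A]) /=.
  apply: eq_bigr => j jA; apply: eq_bigl => S.
  by rewrite !inE jA subsetD1 andbT andbAC.
by move=> S j _; rewrite inE => /andP[].
Qed.

(** Each (s+1)-set arises s+1 times, once for each choice of its first element; the weights agree
    since [(s+1) C(n, s+1) = n C(n-1, s)]. *)
Lemma avg_draws_first A s (F : {set I} -> R) : (s < #|A|)%N ->
  avg (draws A s.+1) F =
  avg A (fun j => avg (draws (A :\ j) s) (fun S => F (j |: S))).
Proof.
move=> sA; have := sum_draws_first A s (fun Q _ => F Q).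
under eq_bigr => Q; first rewrite inE => /andP[_ /eqP cQ].
  rewrite sumr_const cQ -[_ *+ _]mulr_natl; over.
rewrite -mulr_sumr => E.
rewrite /avg.
under [in RHS]eq_bigr => j jA.
  rewrite cards_draws (_ : #|A :\ j| = #|A|.-1); last by rewrite (cardsD1 j A) jA.
  over.
rewrite -mulr_sumr -E cards_draws !mulrA; congr (_ * _).
have /(congr1 (fun n => n%:R : R)) := mul_bin_diag #|A| s.
rewrite !natrM => E'.
have b1 : 'C(#|A|, s.+1)%:R != 0 :> R by rewrite pnatr_eq0 -lt0n bin_gt0.
have b2 : 'C(#|A|.-1, s)%:R != 0 :> R by rewrite pnatr_eq0 -lt0n bin_gt0; lia.
have b3 : #|A|%:R != 0 :> R by rewrite pnatr_eq0; lia.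
by rewrite -invfM E' invfM mulrAC mulVf ?mul1r // pnatr_eq0.
Qed.

Lemma card_extensions S A m : S \subset A -> (#|S| <= m)%N ->
  #|extensions S A m| = 'C((#|A| - #|S|)%N, (m - #|S|)%N).
Proof.
move=> SA Sm; rewrite -cardsDS // -cards_draws.
have inj : {in draws (A :\: S) (m - #|S|)%N &, injective (fun B => S :|: B)}.
  move=> B B'; rewrite !inE !subsetD => /andP[/andP[_ dB] _] /andP[/andP[_ dB'] _] E.
  have K (C : {set I}) : [disjoint C & S] -> (S :|: C) :\: S = C.
    by move=> dC; rewrite setDUl setDv set0U; apply/setDidPl.
  by rewrite -(K _ dB) -(K _ dB') E.
rewrite -(card_in_imset inj).
congr #|pred_of_set _|; apply/setP => S'; rewrite inE.
apply/and3P/imsetP => [[SS' S'A /eqP cS']|[B]].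
  exists (S' :\: S); last by have := setID S' S; rewrite (setIidPr SS').
  by rewrite inE setSD // cardsDS // cS' eqxx.
rewrite !inE subsetD => /andP[/andP[BA dBS] /eqP cB] ->.
split; [exact: subsetUl | by rewrite subUset SA BA |].
rewrite (eqTleqif (leq_card_setU _ _)) ?cB; last by rewrite disjoint_sym.
by rewrite subnKC.
Qed.

(** This reverses the order of drawing: given the next sample [S'], the current sample [S] is a
    uniform s-subset of it. *)
Lemma avg_draws_exchange A s m (phi : {set I} -> {set I} -> R) :
  (s <= m <= #|A|)%N ->
  avg (draws A s) (fun S => avg (extensions S A m) (phi S)) =
  avg (draws A m) (fun S' => avg (draws S' s) (fun S => phi S S')).
Proof.
move=> /andP[sm mA].
have card_ext S : S \in draws A s ->
  #|extensions S A m| = 'C((#|A| - s)%N, (m - s)%N).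
  by rewrite inE => /andP[SA /eqP cS]; rewrite card_extensions ?cS.
have exchange (psi : {set I} -> {set I} -> R) :
    \sum_(S in draws A s) \sum_(S' in extensions S A m) psi S S' =
    \sum_(S' in draws A m) \sum_(S in draws S' s) psi S S'.
  rewrite (exchange_big_dep [in draws A m]) /=.
    apply: eq_bigr => S' S'm; apply: eq_bigl => S; move: S'm; rewrite !inE.
    case: (boolP (S \subset S')) => [SS'|]; rewrite ?andbF //= => /andP[S'A ->].
    by rewrite S'A (subset_trans SS' S'A) /= andbT.
  by move=> S S'; rewrite !inE => _ /and3P[_ -> ->].
(* Counting the pairs in two ways gives [C(n, s) C(n-s, m-s) = C(n, m) C(m, s)], so the normalizing
   factors agree. *)
have count := exchange (fun _ _ => 1).
rewrite (eq_bigr (fun _ => 'C((#|A| - s)%N, (m - s)%N)%:R)) in count; last first.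
  by move=> S Sm; rewrite sumr_const card_ext.
rewrite [in RHS](eq_bigr (fun _ => 'C(m, s)%:R)) in count; last first.
  by move=> S'; rewrite inE => /andP[_ /eqP cS']; rewrite sumr_const cards_draws cS'.
rewrite !sumr_const !cards_draws -!mulrnA in count.
rewrite /avg (eq_bigr _ (fun S Sm => congr1 (fun k => k%:R^-1 * _) (card_ext S Sm))).
rewrite [in RHS](eq_bigr (fun S' =>
  'C(m, s)%:R^-1 * \sum_(S in draws S' s) phi S S')); last first.
  by move=> S'; rewrite inE => /andP[_ /eqP cS']; rewrite cards_draws cS'.
rewrite -!mulr_sumr exchange !mulrA -!invfM !cards_draws; congr (_^-1 * _).
by rewrite -!natrM mulnC count mulnC.
Qed.

End Sampling.

(** * Tail bound for a hypergeometric count *)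

Section Tail.
Variables (R : realType) (I : finType).
Implicit Types (A S Q D : {set I}).

(* Drawing one element first changes the conditional mean of [#|S :&: D|] by at
   most one, so the two-point bound applies to each of the [s] draws. *)
Lemma draws_mgf A D s (l : R) : D \subset A -> (s <= #|A|)%N -> 0 <= l ->
  avg (draws A s) (fun S => expR (l * #|S :&: D|%:R)) <=
  expR (l * (s%:R * #|D|%:R / #|A|%:R) + l ^+ 2 * s%:R / 8).
Proof.
move=> + + l0; elim: s A D => [|s IH] A D DA sA.
  rewrite !mul0r !mulr0 mul0r addr0 expR0 -[X in _ <= X](@avg_const R _ (draws A 0)).
    apply: le_avg => S; rewrite inE cards_eq0 => /andP[_ /eqP ->].
    by rewrite set0I cards0 mulr0 expR0.
  exact: draws_neq0.
rewrite avg_draws_first //.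
pose N := #|A|%:R : R; pose d := #|D|%:R : R.
pose N1 := #|A|.-1%:R : R.
have NE : N = N1 + 1 by rewrite /N /N1 natr1 prednK //; lia.
have N0 : 0 < N by rewrite ltr0n; lia.
have dN : d <= N by rewrite ler_nat subset_leq_card.
have sN1 : s%:R <= N1 by rewrite ler_nat; lia.
(* The conditional mean of the count, [b] telling whether the first element drawn lies in [D]. *)
pose m (b : bool) := b%:R + s%:R * (d - b%:R) / N1.
have first j : j \in A ->
    avg (draws (A :\ j) s) (fun S => expR (l * #|(j |: S) :&: D|%:R)) <=
    expR (l * m (j \in D) + l ^+ 2 * s%:R / 8).
  move=> jA; have cA : #|A :\ j| = #|A|.-1 by rewrite (cardsD1 j A) jA.
  have sAj : (s <= #|A :\ j|)%N by rewrite cA; lia.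
  have jS S : S \in draws (A :\ j) s -> j \notin S.
    by rewrite inE subsetD1 => /andP[/andP[]].
  rewrite /m; case: (boolP (j \in D)) => jD.
    rewrite (eq_avg (psi := fun S => expR l * expR (l * #|S :&: (D :\ j)|%:R))).
      rewrite avgZ (le_trans (ler_wpM2l (expR_ge0 l) (IH _ _ (setSD _ DA) sAj))) //.
      rewrite -expRD ler_expR cA [X in _ <=
        _ * (_ + _ * X / _) + _](_ : _ = #|D :\ j|%:R).
        by rewrite -/N1 /= mulr1n le_eqVlt; apply/orP; left; apply/eqP; ring.
      by rewrite /d (cardsD1 j D) jD add1n -natr1 addrK.
    move=> S /jS jS'; rewrite -[RHS]expRD -[X in _ = expR (X + _)]mulr1 -mulrDr.
    congr (expR (_ * _)).
    rewrite setIUl (setIidPl _) ?sub1set // cardsU1 inE (negPf jS') /= natrD.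
    congr (_ + _%:R); congr #|pred_of_set _|; apply/setP => i; rewrite !inE.
    by case: eqP => //= ->; rewrite (negPf jS').
  rewrite add0r subr0.
  have DAj : D \subset A :\ j by rewrite subsetD1 DA.
  rewrite (eq_avg (psi := fun S => expR (l * #|S :&: D|%:R))).
    by apply: le_trans (IH _ _ DAj sAj) _; rewrite cA.
  move=> S _; congr (expR (_ * #|pred_of_set _|%:R)); apply/setP => i; rewrite !inE.
  by case: eqP => //= ->; rewrite (negPf jD) andbF.
apply: (le_trans (le_avg first)).
(* This is [m true - m false], the effect of the first draw on the mean. *)
pose c := 1 - s%:R / N1.
have c01 : 0 <= c <= 1.
  rewrite subr_ge0 gerBl divr_ge0 //= ?andbT /N1 //.
  have [->|N10] := eqVneq #|A|.-1 0%N; first by rewrite invr0 mulr0.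
  by rewrite ler_pdivrMr ?mul1r // ltr0n lt0n.
pose p := d / N.
have p01 : 0 <= p <= 1 by rewrite divr_ge0 //= ?ler_pdivrMr ?mul1r ?ler0n //.
have -> : avg A (fun j => expR (l * m (j \in D) + l ^+ 2 * s%:R / 8)) =
    expR (l * m false + l ^+ 2 * s%:R / 8) * (1 - p + p * expR (l * c)).
  have mt : expR (l * m true + l ^+ 2 * s%:R / 8) =
      expR (l * m false + l ^+ 2 * s%:R / 8) * expR (l * c).
    rewrite -expRD; congr expR; rewrite /m /c /=; ring.
  rewrite /avg (big_setID D) /= (setIidPr DA).
  rewrite (eq_bigr (fun=> expR (l * m true + l ^+ 2 * s%:R / 8))); last first.
    by move=> i ->.
  rewrite [X in _ + X](eq_bigr (fun=> expR (l * m false + l ^+ 2 * s%:R / 8)));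
    last first.
    by move=> i; rewrite inE => /andP[/negPf -> _].
  rewrite !sumr_const cardsDS //.
  rewrite -[X in _ * (X + _)]mulr_natl -[X in _ * (_ + X)]mulr_natl natrB
    ?subset_leq_card // mt -/N -/d /p.
  move: (expR _) (expR _) (lt0r_neq0 N0) => E1 E2; clear; clearbody N d => N0.
  by field.
rewrite (le_trans (ler_wpM2l (expR_ge0 _) (hoeffding_two_point p01 _))) //.
  by rewrite mulr_ge0 //; case/andP: c01.
rewrite -expRD ler_expR.
have -> : l * m false + l ^+ 2 * s%:R / 8 + (l * c * p + (l * c) ^+ 2 / 8) =
   l * (s.+1%:R * d / N) + l ^+ 2 * s%:R / 8 + l ^+ 2 * (c ^+ 2) / 8.
  rewrite /m /c /p NE -[s.+1%:R]natr1 /=.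
  (* If [N1 = 0], then [s = 0] and the quotients by [N1] are 0 by convention. *)
  have [N10|N10] := eqVneq N1 0.
    have -> : s%:R = 0 :> R by apply/eqP; rewrite eq_le ler0n andbT -N10.
    by rewrite N10 invr0; field.
  by field; rewrite N10 -NE gt_eqF.
rewrite -addrA lerD2l -[s.+1%:R]natr1 mulrDr mulr1 mulrDl lerD2l ler_pdivlMr //
  divfK ?pnatr_eq0 //.
rewrite ler_piMr ?sqr_ge0 // expr_le1 //; by case/andP: c01.
Qed.

(** Chernoff's method: the indicator is at most [exp (l (#|S :&: D| - a))], whose average is bounded
    by [draws_mgf]. *)
Lemma draws_tail A D s (t : R) : D \subset A -> (0 < s <= #|A|)%N -> 0 <= t ->
  avg (draws A s) (fun S => (s%:R * #|D|%:R / #|A|%:R + t <=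
    #|S :&: D|%:R :> R)%R%:R) <=
  expR (- (2 * t ^+ 2 / s%:R)).
Proof.
move=> DA /andP[s0 sA] t0.
have sR : 0 < s%:R :> R by rewrite ltr0n.
(* The minimizer of [l^2 s / 8 - l t]; the minimum is [- 2 t^2 / s]. *)
pose l := 4 * t / s%:R.
have l0 : 0 <= l by rewrite divr_ge0 ?mulr_ge0.
pose a := s%:R * #|D|%:R / #|A|%:R + t.
apply: le_trans (_ : avg (draws A s) (fun S => expR (- (l * a)) *
                        expR (l * #|S :&: D|%:R)) <= _).
  apply: le_avg => S _; rewrite -expRD -/a.
  case: (boolP (a <= _)) => [aS|_]; last exact: expR_ge0.
  by rewrite -[X in X <= _]expR0 ler_expR addrC subr_ge0 ler_wpM2l.
rewrite avgZ (le_trans (ler_wpM2l (expR_ge0 _) (draws_mgf DA sA l0))) //.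
rewrite -expRD ler_expR le_eqVlt; apply/orP; left; apply/eqP.
rewrite /a /l; set x := _ / #|A|%:R; field; exact: lt0r_neq0.
Qed.

End Tail.

(** * Ranks in a sample *)

Section Ranks.
Variables (I : finType) (d : Order.disp_t) (T : orderType d) (x : I -> T).
Implicit Types (S Q D : {set I}) (a b i : nat).

Definition lt_count S (j : I) := #|[set l in S | (x l < x j)%O]|.
Definition le_count S (j : I) := #|[set l in S | (x l <= x j)%O]|.

(* If [u] and [v] have ranks [i <= j] in [S] and [S \subset S'], the sets L, M and
   R of step 4 are [strip S 0 i S'], [strip S i j S'] and [strip S j #|S|.+1 S']. *)
Definition strip S a b Q :=
  [set j in Q | (a <= lt_count S j)%N && (le_count S j < b)%N].

Lemma lt_count_mono S (j l : I) : (x j <= x l)%O -> (lt_count S j <= lt_count S l)%N.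
Proof.
move=> jl; apply/subset_leq_card/subsetP => m; rewrite !inE => /andP[-> mj].
exact: lt_le_trans jl.
Qed.

Lemma le_count_mono S (j l : I) : (x j <= x l)%O -> (le_count S j <= le_count S l)%N.
Proof.
move=> jl; apply/subset_leq_card/subsetP => m; rewrite !inE => /andP[-> mj].
exact: le_trans jl.
Qed.

Lemma le_count_lt_count S (j l : I) : (x j < x l)%O ->
  (le_count S j <= lt_count S l)%N.
Proof.
move=> jl; apply/subset_leq_card/subsetP => m; rewrite !inE => /andP[-> mj].
exact: le_lt_trans jl.
Qed.

Lemma le_count_max S (j : I) : (le_count S j <= #|S|)%N.
Proof. by apply/subset_leq_card/subsetP => m; rewrite !inE => /andP[]. Qed.

(** The right-hand side depends on [S] and [i] only, so the pivot can be eliminated from the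
    costs. *)
Lemma kth_smallest_ltl S i u (j : I) : (0 < i)%N -> kth_smallest x S i u ->
  (x j < x u)%O = (le_count S j < i)%N.
Proof.
move=> i0 /and3P[uS lo hi]; apply/idP/idP => [/(le_count_lt_count S) ju|].
  by rewrite (leq_ltn_trans ju) // (leq_ltn_trans lo) // prednK.
by apply: contraTT; rewrite -leNgt -leqNgt => /(le_count_mono S); exact: leq_trans.
Qed.

Lemma kth_smallest_ltr S i u (j : I) : (0 < i)%N -> kth_smallest x S i u ->
  (x u < x j)%O = (i <= lt_count S j)%N.
Proof.
move=> i0 /and3P[uS lo hi]; apply/idP/idP => [/(le_count_lt_count S)|].
  exact: leq_trans.
apply: contraTT; rewrite -leNgt -ltnNge => /(lt_count_mono S) ju.
by rewrite (leq_ltn_trans ju) // (leq_ltn_trans lo) // prednK.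
Qed.

(** Let [jmin] and [jmax] be extreme elements of the set. It is disjoint from the at least [a]
    elements below [jmin], and together they lie among the at most [b] elements up to [jmax]. *)
Lemma card_rank_le Q a b :
  (#|[set j in Q | (a <= lt_count Q j)%N && (le_count Q j <= b)%N]| <= b - a)%N.
Proof.
set D := [set j in Q | _]; have [->|/set0Pn[j0 j0D]] := eqVneq D set0.
  by rewrite cards0.
have [jmax maxD maxP] := arg_maxP x j0D.
have {}maxD : jmax \in D := maxD.
have {}maxP (l : I) : l \in D -> (x l <= x jmax)%O := maxP l.
have [jmin minD minP] := arg_minP x j0D.
have {}minD : jmin \in D := minD.
have {}minP (l : I) : l \in D -> (x jmin <= x l)%O := minP l.
suff : (#|D| + lt_count Q jmin <= le_count Q jmax)%N.
  by move: maxD minD; rewrite !inE => /andP[_ /andP[_ +]] /andP[_ /andP[+ _]]; lia.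
have dis : [disjoint D & [set l in Q | (x l < x jmin)%O]].
  apply/pred0P => l /=; rewrite [l \in [set _ in _ | _]]inE.
  by apply/negP => /andP[/minP + /andP[_]]; rewrite leNgt => /negP.
rewrite -(eqTleqif (leq_card_setU _ _) dis).
apply/subset_leq_card/subsetP => l; rewrite in_setU inE => /orP[lD|].
  by rewrite inE (maxP _ lD) andbT; move: lD; rewrite inE => /andP[].
by rewrite inE => /andP[-> /ltW h]; rewrite (le_trans h) // maxP.
Qed.

Variable R : realType.

(** Moving [j] into the sample turns the sum into one over (s+1)-sets [Q], each contributing at most
    [b - a] by [card_rank_le]; the factor is [C(N, s+1) / C(N, s)] with [N = #|S'|]. *)
Lemma avg_strip_outside S' s a b : (s < #|S'|)%N ->
  avg (draws S' s) (fun S => #|strip S a b (S' :\: S)|%:R : R) <=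
  (#|S'| - s)%:R / s.+1%:R * (b - a)%:R.
Proof.
move=> sS'.
(* In [j |: S] the element [j] counts itself in [le_count] but not in [lt_count], so the strict
   bound [b] becomes a weak one. *)
pose G Q j := ((a <= lt_count Q j)%N && (le_count Q j <= b)%N)%:R : R.
rewrite /avg (eq_bigr (fun S => \sum_(j in S' :\: S) G (j |: S) j)); last first.
  move=> S _; rewrite /strip -sum1dep_card natr_sum big_mkcondr /=.
  apply: eq_bigr => j; rewrite inE => /andP[jS _]; rewrite /G.
  have -> : lt_count (j |: S) j = lt_count S j.
    congr #|pred_of_set _|; apply/setP => l; rewrite !inE.
    by case: eqP => //= ->; rewrite ltxx andbF.
  have -> : le_count (j |: S) j = (le_count S j).+1.
    transitivity ((j \notin [set l in S | (x l <= x j)%O]) + le_count S j)%N;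
      last first.
      by rewrite inE (negPf jS).
    rewrite -cardsU1; congr #|pred_of_set _|; apply/setP => l; rewrite !inE.
    by case: eqP => //= ->; rewrite lexx.
  by case: ifP.
rewrite -sum_draws_insert cards_draws.
apply: le_trans (_ : 'C(#|S'|, s)%:R^-1 * ('C(#|S'|, s.+1)%:R * (b - a)%:R) <= _).
  rewrite ler_wpM2l ?invr_ge0 //.
  apply: le_trans (_ : \sum_(Q in draws S' s.+1) (b - a)%:R <= _); last first.
    by rewrite sumr_const cards_draws mulr_natl.
  apply: ler_sum => Q _; rewrite /G -natr_sum ler_nat.
  rewrite (leq_trans _ (card_rank_le Q a b)) // -sum1dep_card big_mkcondr /=.
  by apply: leq_sum => j _; case: ifP.
rewrite mulrA ler_wpM2r // mulrC ler_pdivrMr ?ltr0n ?bin_gt0 ?(ltnW sS') //.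
rewrite mulrAC ler_pdivlMr ?ltr0n // -!natrM ler_nat mulnC mul_bin_left.
by [].
Qed.

(** The elements of [S] itself add at most [b - a], and [(N - s) / (s + 1) + 1 = (N + 1) / (s +
    1)]. *)
Lemma avg_strip S' s a b : (s < #|S'|)%N ->
  avg (draws S' s) (fun S => #|strip S a b S'|%:R : R) <=
  #|S'|.+1%:R / s.+1%:R * (b - a)%:R.
Proof.
move=> sS'.
apply: le_trans (_ : avg (draws S' s) (fun S =>
   (b - a)%:R + #|strip S a b (S' :\: S)|%:R) <= _).
  apply: le_avg => S; rewrite inE => /andP[SS' _]; rewrite -natrD ler_nat.
  apply: leq_trans (_ : #|strip S a b S :|: strip S a b (S' :\: S)| <= _)%N.
    apply/subset_leq_card/subsetP => j; rewrite !inE => /andP[-> ->].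
    by case: (j \in S).
  apply: leq_trans (leq_card_setU _ _).1 _; rewrite leq_add2r.
  case: b => [|b].
    rewrite leqn0 cards_eq0; apply/eqP/setP => j; rewrite !inE.
    by rewrite ltn0 !andbF.
  by apply: leq_trans (card_rank_le S a b) _; rewrite leq_sub2r.
rewrite avgD avg_const ?draws_neq0 1?ltnW //.
rewrite (le_trans (lerD (lexx _) (avg_strip_outside a b sS'))) //.
rewrite -{1}[(b - a)%:R]mul1r -mulrDl ler_wpM2r //.
rewrite -[X in X + _](@divff _ s.+1%:R) ?pnatr_eq0 // -mulrDl ler_wpM2r ?invr_ge0 //.
by rewrite -natrD ler_nat; lia.
Qed.

(** If L has at least [i'] elements, it contains all those with fewer than [i'] elements of [S']
    below them. The largest sampled one has fewer than [i] sample elements up to it, hence the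
    bound. *)
Lemma strip_below_large S S' i i' : S \subset S' -> (0 < i)%N ->
  (i' <= #|strip S 0 i S'|)%N ->
  (#|S :&: [set j in S' | (lt_count S' j < i')%N]| < i)%N.
Proof.
move=> SS' i0 h; set D := [set j in S' | _].
have DL : D \subset strip S 0 i S'.
  apply/subsetP => j; rewrite !inE => /andP[jS' jD]; rewrite jS' /= ltnNge.
  apply/negP => ij; move: (leq_trans jD h); apply/negP; rewrite -leqNgt.
  apply/subset_leq_card/subsetP => l; rewrite !inE => /andP[-> /= li].
  rewrite ltNge; apply/negP => /(le_count_mono S); apply/negP; rewrite -ltnNge.
  exact: leq_trans ij.
have [->|/set0Pn[j0 j0D]] := eqVneq (S :&: D) set0; first by rewrite cards0.
have [j jD jmax] := arg_maxP x j0D.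
have {}jD : j \in S :&: D := jD.
have {}jmax (l : I) : l \in S :&: D -> (x l <= x j)%O := jmax l.
move: (jD); rewrite inE => /andP[jS /(subsetP DL)]; rewrite inE => /andP[_ /=].
apply: leq_ltn_trans; apply/subset_leq_card/subsetP => l lD; rewrite inE.
by move: (lD); rewrite inE => /andP[-> _] /=; apply: jmax.
Qed.

(** Outside [V] an element has at most [#|S'| - #|V| < i'] elements of [S'] up to it. At most
    [#|S| - i] sample elements lie in [V], so at least [i] lie outside. *)
Lemma strip_above_large S S' i i' : S \subset S' -> (0 < i <= #|S|)%N ->
  (#|S'| - #|strip S i #|S|.+1 S'| < i')%N ->
  (i <= #|S :&: [set j in S' | (le_count S' j < i')%N]|)%N.
Proof.
move=> SS' /andP[i0 iS]; set V := strip _ _ _ _; set D := [set j in S' | _] => h.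
have VS' : V \subset S' by apply/subsetP => j; rewrite inE => /andP[].
have VE j : j \in S' -> (j \in V) = (i <= lt_count S j)%N.
  by move=> jS'; rewrite inE jS' ltnS le_count_max andbT.
rewrite -cardsDS // in h.
have VD : S' :\: V \subset D.
  apply/subsetP => j; rewrite in_setD => /andP[jV jS']; rewrite inE jS' /=.
  apply: leq_ltn_trans h; apply/subset_leq_card/subsetP => l.
  rewrite !inE => /andP[lS' lj]; rewrite lS' andbT /= ltnS le_count_max andbT.
  rewrite VE // in jV; apply: contra jV => /leq_trans; apply.
  exact: lt_count_mono.
apply: leq_trans (_ : #|S :&: (S' :\: V)| <= _)%N; last first.
  by apply: subset_leq_card; exact: setIS.
have -> : S :&: (S' :\: V) =
    S :\: [set j in S | (i <= lt_count S j)%N && (le_count S j <= #|S|)%N].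
  apply/setP => j; rewrite !inE ltnS le_count_max !andbT.
  case jS: (j \in S) => //=; rewrite (subsetP SS') //.
rewrite cardsDS; last by apply/subsetP => j; rewrite inE => /andP[].
have := card_rank_le S i #|S|; lia.
Qed.

End Ranks.

(** * Estimates for sample sizes, ranks and gaps *)

Lemma natr_abs_ge0 (R : pzRingType) (z : int) : 0 <= z -> (`|z|%N)%:R = z%:~R :> R.
Proof. by move=> z0; rewrite pmulrn gez0_abs. Qed.

Section Sizes.
Variables (R : realType) (r beta : R).
Hypothesis r1 : 1 < r.
Hypothesis hbeta : 1 / 4 * (1 - r^-1) ^- 2 <= beta.
Implicit Types (n k s : nat).

Let r0 : 0 < r. Proof. exact: lt_trans r1. Qed.
Let kappa1 : 0 < 1 - r^-1. Proof. by rewrite subr_gt0 invf_lt1. Qed.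
Let beta0 : 0 <= beta.
Proof.
apply: le_trans hbeta; rewrite mulr_ge0 ?divr_ge0 // invr_ge0 exprn_ge0 //.
exact: ltW.
Qed.

Lemma gap_ge0 n s : 0 <= gap beta n s.
Proof. by rewrite /gap; case: ifP => // _; exact: sqrtr_ge0. Qed.

Lemma theta_ge0 n k : 0 <= theta R n k.
Proof. by rewrite divr_ge0. Qed.

Lemma theta_le1 n k : (k <= n)%N -> theta R n k <= 1.
Proof.
case: n => [|n] kn; first by rewrite /theta invr0 mulr0.
by rewrite ler_pdivrMr ?ltr0n // mul1r ler_nat.
Qed.

Lemma lower_rank_ge n k s :
  theta R n k * s%:R - gap beta n s <= (lower_rank beta n k s)%:R.
Proof.
rewrite /lower_rank natr_abs_ge0; last by rewrite le_max ler01 orbT.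
by rewrite (le_trans (ceil_ge _)) // ler_int le_max lexx.
Qed.

(** The hypothesis says that the truncation at 1 is inactive. Likewise [upper_rank_ge] assumes that
    the truncation at [s] is inactive. *)
Lemma lower_rank_lt n k s : (1 < lower_rank beta n k s)%N ->
  (lower_rank beta n k s)%:R - 1 < theta R n k * s%:R - gap beta n s.
Proof.
rewrite /lower_rank; set z := Num.ceil _ => z1.
have : 1 < Num.max z 1.
  by rewrite -[X in _ < X]gez0_abs ?ltz_nat // le_max ler01 orbT.
rewrite lt_max ltxx orbF => {}z1; rewrite (max_idPl (ltW z1)).
rewrite natr_abs_ge0 ?(le_trans _ (ltW z1)) //.
by have := ceilB1_lt (theta R n k * s%:R - gap beta n s); rewrite intrB.
Qed.

Lemma upper_rank_lt n k s :
  (upper_rank beta n k s)%:R - 1 < theta R n k * s%:R + gap beta n s.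
Proof.
have z0 : 0 <= theta R n k * s%:R + gap beta n s.
  by rewrite addr_ge0 ?gap_ge0 // mulr_ge0 ?theta_ge0.
rewrite /upper_rank natr_abs_ge0;
  last by rewrite le_min ceil_ge0 ?(lt_le_trans _ z0) //= ltrN10.
apply: le_lt_trans (_ : (Num.ceil (theta R n k * s%:R + gap beta n s))%:~R - 1 < _).
  by rewrite lerD2r ler_int ge_min lexx.
by have := ceilB1_lt (theta R n k * s%:R + gap beta n s); rewrite intrB.
Qed.

Lemma upper_rank_ge n k s : (upper_rank beta n k s < s)%N ->
  theta R n k * s%:R + gap beta n s <= (upper_rank beta n k s)%:R.
Proof.
have z0 : 0 <= theta R n k * s%:R + gap beta n s.
  by rewrite addr_ge0 ?gap_ge0 // mulr_ge0 ?theta_ge0.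
have c0 : 0 <= Num.ceil (theta R n k * s%:R + gap beta n s).
  by rewrite ceil_ge0 (lt_le_trans _ z0) // ltrN10.
rewrite /upper_rank -ltz_nat gez0_abs ?le_min ?c0 // => zs.
rewrite natr_abs_ge0 ?le_min ?c0 //.
by move: zs; rewrite gt_min ltxx orbF => /ltW/min_idPl ->; exact: ceil_ge.
Qed.

Lemma next_size_le n s : (next_size r n s)%:R <= r ^+ 2 * s%:R + 1.
Proof.
apply: le_trans (_ : `|Num.ceil (r ^+ 2 * s%:R)|%N%:R <= _).
  by rewrite ler_nat geq_minl.
have x0 : 0 <= r ^+ 2 * s%:R by rewrite mulr_ge0 // sqr_ge0.
rewrite natr_abs_ge0; last by rewrite ceil_ge0 (lt_le_trans _ x0) // ltrN10.
by have := ceilB1_lt (r ^+ 2 * s%:R); rewrite intrB => /ltW; rewrite lerBlDr.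
Qed.

Lemma next_size_ge n s : next_size r n s != n ->
  r ^+ 2 * s%:R <= (next_size r n s)%:R.
Proof.
have x0 : 0 <= r ^+ 2 * s%:R by rewrite mulr_ge0 // sqr_ge0.
rewrite /next_size; case: leqP => [_ _|_ /eqP//].
rewrite natr_abs_ge0; last by rewrite ceil_ge0 (lt_le_trans _ x0) // ltrN10.
exact: ceil_ge.
Qed.

Lemma gapE n s : (s < n)%N ->
  gap beta n s = Num.sqrt beta * (Num.sqrt s%:R * Num.sqrt (ln n%:R)).
Proof.
by move=> sn; rewrite /gap ltn_eqF // sqrtrM ?mulr_ge0 // sqrtrM // mulrA.
Qed.

(* [(1 - 1/r) g_l] is what is left of the gap between consecutive ranks after
   scaling [S_(l+1)] down to [S_l]. *)
Lemma gap_next n s : (0 < s < n)%N ->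
  gap beta n (next_size r n s) * s%:R / (next_size r n s)%:R <= r^-1 * gap beta n s.
Proof.
move=> sn; have /andP[sN Nn] := next_size_bounds r1 sn.
move: sn => /andP[s0 sn].
set N := next_size r n s in sN Nn *.
have N0 : 0 < N%:R :> R by rewrite ltr0n; lia.
have [NEn|Nn'] := eqVneq N n.
  by rewrite {1}/gap NEn eqxx !mul0r mulr_ge0 ?invr_ge0 ?gap_ge0 // ltW.
have {Nn'}Nn : (N < n)%N by rewrite ltn_neqAle Nn'.
(* Before the last sample no truncation occurs, so the sizes grow by a factor of at least [r^2] and
   the gaps by at least [r]. *)
have h : r * Num.sqrt s%:R <= Num.sqrt N%:R.
  rewrite -[r]gtr0_norm // -sqrtr_sqr -sqrtrM ?sqr_ge0 // ler_wsqrtr //.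
  by apply: next_size_ge; rewrite ltn_eqF.
have sq (m : nat) : m%:R = Num.sqrt m%:R ^+ 2 :> R by rewrite sqr_sqrtr.
have sN0 : 0 < Num.sqrt N%:R :> R by rewrite sqrtr_gt0.
rewrite !gapE // [X in _ * X / _](sq s) [X in _ / X](sq N).
have := sqrtr_ge0 (ln n%:R : R); have := sqrtr_ge0 (s%:R : R);
  move: h sN0 (sqrtr_ge0 beta).
move: (Num.sqrt N%:R) (Num.sqrt beta) (Num.sqrt s%:R) (Num.sqrt (ln n%:R)).
move=> b c a q h b0 c0 a0 q0.
have -> : c * (b * q) * a ^+ 2 / b ^+ 2 = c * q * (a * (a / b)).
  by field; rewrite gt_eqF.
have -> : r^-1 * (c * (a * q)) = c * q * (a * r^-1) by ring.
rewrite !ler_wpM2l ?mulr_ge0 // ler_pdivrMr // -(ler_pM2l r0) mulrA.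
by rewrite divff ?gt_eqF // mul1r.
Qed.

(** The lower bound on [beta] gives [2 (1 - 1/r)^2 beta >= 1/2], so the exponent is at most
    [- ln n / 2]. *)
Lemma tail_exponent n s : (0 < s < n)%N ->
  expR (- (2 * ((1 - r^-1) * gap beta n s) ^+ 2 / s%:R)) <= (Num.sqrt n%:R)^-1 :> R.
Proof.
move=> /andP[s0 sn]; have sR : 0 < s%:R :> R by rewrite ltr0n.
have nR : 1 <= n%:R :> R by rewrite ler1n; lia.
have n0 : 0 < n%:R :> R by rewrite (lt_le_trans _ nR).
have l0 := ln_ge0 nR.
rewrite exprMn /gap ltn_eqF // sqr_sqrtr ?mulr_ge0 //.
have -> : 2 * ((1 - r^-1) ^+ 2 * (beta * s%:R * ln n%:R)) / s%:R =
          2 * ((1 - r^-1) ^+ 2 * beta) * ln n%:R.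
  by field; rewrite !gt_eqF.
have b4 : 1 / 4 <= (1 - r^-1) ^+ 2 * beta.
  have := ler_wpM2l (sqr_ge0 (1 - r^-1)) hbeta.
  by rewrite mulrCA divff ?mulr1 // expf_neq0 // gt_eqF.
apply: le_trans (_ : expR (- (ln n%:R / 2)) <= _).
  by rewrite ler_expR lerN2; nra.
rewrite expRN lef_pV2 ?posrE ?expR_gt0 ?sqrtr_gt0 //.
rewrite -[expR _]gtr0_norm ?expR_gt0 // -sqrtr_sqr ler_wsqrtr //.
by rewrite -expRM_natl mulrC divfK ?pnatr_eq0 // lnK.
Qed.

End Sizes.

(** * Cost of a round *)

Section Stage.
Variables (R : realType) (r beta : R).
Hypothesis r1 : 1 < r.
Hypothesis hbeta : 1 / 4 * (1 - r^-1) ^- 2 <= beta.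
Variables (I : finType) (d : Order.disp_t) (T : orderType d) (x : I -> T).
Variables (n k s : nat).
Hypothesis kn : (0 < k <= n)%N.
Hypothesis sn : (0 < s < n)%N.

Let N := next_size r n s.
Let th := theta R n k.
Let g := gap beta n s.
Let iu := lower_rank beta n k s.
Let iv := upper_rank beta n k s.
Let iu' := lower_rank beta n k N.
Let iv' := upper_rank beta n k N.

Variable S' : {set I}.
Hypothesis cS' : #|S'| = N.

Let r0 : 0 < r. Proof. exact: lt_trans r1. Qed.
Let sN : (s < N)%N. Proof. by have /andP[] := next_size_bounds r1 sn. Qed.
Let N0 : (0 < N)%N. Proof. exact: leq_trans sN. Qed.
Let NR : 0 < N%:R :> R. Proof. by rewrite ltr0n. Qed.
Let iub : (0 < iu <= s)%N.
Proof.
have s0 : (0 < s)%N by case/andP: sn.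
by have [-> /leq_trans + ] := rank_bounds beta kn s0; apply.
Qed.
Let ivb : (0 < iv <= s)%N.
Proof.
have s0 : (0 < s)%N by case/andP: sn.
by have [/leq_trans + + ->] := rank_bounds beta kn s0; rewrite andbT; apply.
Qed.
Let iub' : (0 < iu' <= N)%N.
Proof. by have [-> /leq_trans + ] := rank_bounds beta kn N0; apply. Qed.

Lemma sample_rank_tail (D : {set I}) : D \subset S' ->
  avg (draws S' s) (fun S => (s%:R * #|D|%:R / N%:R + (1 - r^-1) * g <=
    #|S :&: D|%:R)%R%:R)
    <= (Num.sqrt n%:R)^-1 :> R.
Proof.
move=> DS'; apply: le_trans (tail_exponent r1 hbeta sn); rewrite -cS'.
apply: draws_tail => //; first by rewrite cS' (ltnW sN); case/andP: sn => ->.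
by rewrite mulr_ge0 ?gap_ge0 // subr_ge0 invf_le1 // ltW.
Qed.

(** If L is searched for rank [iu'], the sample has fewer than [iu] elements in [D], hence fewer
    than [th s - g], while the mean is at least [th s - g / r]. *)
Lemma below_failure : (1 < iu)%N ->
  avg (draws S' s) (fun S => (iu' <= #|strip x S 0 iu S'|)%N%:R) <=
    (Num.sqrt n%:R)^-1 :> R.
Proof.
move=> iu1; set D := [set j in S' | (lt_count x S' j < iu')%N].
(* The tail bound is for upper deviations: too few elements in [D] means too many in its
   complement. *)
apply: le_trans (sample_rank_tail (subsetDl S' D)).
apply: le_avg => S; rewrite inE => /andP[SS' /eqP cS].
have [h|] := boolP (iu' <= _)%N; last by move=> _; exact: ler0n.
have i0 : (0 < iu)%N by case/andP: iub.
have := strip_below_large SS' i0 h; rewrite -/D => SD.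
have DS' : D \subset S' by apply/subsetP => j; rewrite inE => /andP[].
have cD : (iu' <= #|D|)%N.
  have -> : D = S' :\: [set j in S' | (iu' <=
    lt_count x S' j)%N && (le_count x S' j <= N)%N].
    apply/setP => j; rewrite !inE -cS' le_count_max andbT ltnNge.
    by case: (j \in S'); rewrite ?andbT ?andbF.
  rewrite cardsDS; last by apply/subsetP => j; rewrite inE => /andP[].
  by have := card_rank_le x S' iu' N; have := iub'; rewrite cS'; lia.
have E : S :&: (S' :\: D) = S :\: (S :&: D).
  apply/setP => j; rewrite !inE; case jS: (j \in S); rewrite ?andbF //=.
  by rewrite (subsetP SS').
have cE : #|S :&: (S' :\: D)|%:R = s%:R - #|S :&: D|%:R :> R.
  by rewrite E cardsDS ?subsetIl // natrB ?cS // -cS subset_leq_card // subsetIl.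
have cE2 : #|S' :\: D|%:R = N%:R - #|D|%:R :> R.
  by rewrite cardsDS // natrB ?cS' // -cS' subset_leq_card.
rewrite cE cE2.
suff -> : s%:R * (N%:R - #|D|%:R) / N%:R + (1 - r^-1) * g <=
  s%:R - #|S :&: D|%:R by [].
have u1 : #|S :&: D|%:R <= iu%:R - 1 :> R by rewrite lerBrDr natr1 ler_nat.
have u2 := lower_rank_lt iu1.
have u3 : iu'%:R <= #|D|%:R :> R by rewrite ler_nat.
have u4 := @lower_rank_ge R beta n k N.
have u5 := gap_next r1 hbeta sn.
rewrite -/N -/th -/g in u2 u4 u5.
have u6 : s%:R * (N%:R - #|D|%:R) / N%:R <=
  s%:R - th * s%:R + gap beta n N * s%:R / N%:R.
  rewrite ler_pdivrMr // mulrDl mulrBl divfK ?gt_eqF //.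
  have : th * N%:R - gap beta n N <= #|D|%:R by exact: le_trans u4 u3.
  move/(ler_wpM2l (ler0n R s)); lra.
lra.
Qed.

(** Here the sample has at least [iv >= th s + g] elements in [D], while the mean is at most
    [th s + g / r]. *)
Lemma above_failure : (iv < s)%N ->
  avg (draws S' s) (fun S => (N - #|strip x S iv s.+1 S'| < iv')%N%:R)
    <= (Num.sqrt n%:R)^-1 :> R.
Proof.
move=> ivs; set D := [set j in S' | (le_count x S' j < iv')%N].
have DS' : D \subset S' by apply/subsetP => j; rewrite inE => /andP[].
apply: le_trans (sample_rank_tail DS').
apply: le_avg => S; rewrite inE => /andP[SS' /eqP cS].
have [h|] := boolP (_ < iv')%N; last by move=> _; exact: ler0n.
have SD : (iv <= #|S :&: D|)%N.
  by apply: strip_above_large => //; rewrite cS // cS'.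
have iv0 : (0 < iv')%N by exact: leq_ltn_trans h.
have cD : (#|D| <= iv'.-1)%N.
  rewrite -[iv'.-1]subn0; apply: leq_trans (card_rank_le x S' 0 iv'.-1).
  by apply/subset_leq_card/subsetP => j;
    rewrite !inE /= -[(_ <= iv'.-1)%N]ltnS prednK.
suff -> : s%:R * #|D|%:R / N%:R + (1 - r^-1) * g <= #|S :&: D|%:R :> R by [].
have u1 : iv%:R <= #|S :&: D|%:R :> R by rewrite ler_nat.
have u2 := upper_rank_ge ivs.
have u3 : #|D|%:R <= iv'%:R - 1 :> R by rewrite lerBrDr natr1 ler_nat; lia.
have u4 := @upper_rank_lt R beta n k N.
have u5 := gap_next r1 hbeta sn.
rewrite -/N -/th -/g in u2 u4 u5.
have u6 : s%:R * #|D|%:R / N%:R <= th * s%:R + gap beta n N * s%:R / N%:R.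
  rewrite ler_pdivrMr // mulrDl divfK ?gt_eqF //.
  have : #|D|%:R <= th * N%:R + gap beta n N by exact: le_trans u3 (ltW u4).
  move/(ler_wpM2l (ler0n R s)); lra.
lra.
Qed.

Let ratio1 : N.+1%:R / s.+1%:R <= r ^+ 2 + 1.
Proof.
rewrite ler_pdivrMr ?ltr0n // -!natr1.
have := next_size_le r n s; rewrite -/N.
have : 1 <= s%:R :> R by rewrite ler1n; case/andP: sn.
have := sqr_ge0 r; nra.
Qed.

Let ratio2 : (N - s)%:R / s.+1%:R <= r ^+ 2.
Proof.
rewrite ler_pdivrMr ?ltr0n // natrB ?(ltnW sN) // -natr1.
have := next_size_le r n s; rewrite -/N.
have : 1 <= s%:R :> R by rewrite ler1n; case/andP: sn.
have := sqr_ge0 r; nra.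
Qed.

Let avg_le_card (P : {set I} -> bool) (Q : {set I} -> {set I}) :
    (forall S, S \in draws S' s -> Q S \subset S') ->
  avg (draws S' s) (fun S => #|Q S|%:R * (P S)%:R) <=
  N%:R * avg (draws S' s) (fun S => (P S)%:R) :> R.
Proof.
move=> QS; rewrite -avgZ; apply: le_avg => S Sd; rewrite ler_wpM2r // ler_nat -cS'.
exact/subset_leq_card/QS.
Qed.

(** If [iu > 1], the search of L is rare and costs at most [N] elements. If [iu = 1], it may be
    frequent, but [u] is a minimum of the sample and L is small on average. *)
Lemma avg_below_failure :
  avg (draws S' s) (fun S => #|strip x S 0 iu S'|%:R *
                             (iu' <= #|strip x S 0 iu S'|)%N%:R)
    <= r ^+ 2 + 1 + N%:R / Num.sqrt n%:R.
Proof.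
have [iu1|iu1] := ltnP 1 iu.
  apply: (le_trans (avg_le_card _ _)).
    by move=> S _; apply/subsetP => j; rewrite inE => /andP[].
  rewrite (le_trans (ler_wpM2l (ltW NR) (below_failure iu1))) // lerDr.
  by rewrite addr_ge0 ?sqr_ge0.
have iuE : iu = 1%N by have := iub; lia.
apply: le_trans (_ : avg (draws S' s) (fun S => #|strip x S 0 iu S'|%:R) <= _).
  by apply: le_avg => S _; rewrite ler_piMr // lern1 leq_b1.
apply: le_trans (avg_strip x R 0 iu _) _; first by rewrite cS'.
rewrite iuE subn0 mulr1 cS' (le_trans ratio1) // lerDl.
by rewrite divr_ge0 ?sqrtr_ge0.
Qed.

Lemma avg_above_failure :
  avg (draws S' s) (fun S => #|strip x S iv s.+1 S'|%:R *
                             (N - #|strip x S iv s.+1 S'| < iv')%N%:R)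
    <= r ^+ 2 + 1 + N%:R / Num.sqrt n%:R.
Proof.
have [ivs|ivs] := ltnP iv s.
  apply: (le_trans (avg_le_card _ _)).
    by move=> S _; apply/subsetP => j; rewrite inE => /andP[].
  rewrite (le_trans (ler_wpM2l (ltW NR) (above_failure ivs))) // lerDr.
  by rewrite addr_ge0 ?sqr_ge0.
have ivE : iv = s by have := ivb; lia.
apply: le_trans (_ : avg (draws S' s) (fun S => #|strip x S iv s.+1 S'|%:R) <= _).
  by apply: le_avg => S _; rewrite ler_piMr // lern1 leq_b1.
apply: le_trans (avg_strip x R iv s.+1 _) _; first by rewrite cS'.
rewrite ivE subSnn mulr1 cS' (le_trans ratio1) // lerDl.
by rewrite divr_ge0 ?sqrtr_ge0.
Qed.

Lemma avg_middle :
  avg (draws S' s) (fun S => #|strip x S iu iv S'|%:R) <= (r ^+ 2 + 1) * (2 * g + 1).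
Proof.
apply: le_trans (avg_strip x R iu iv _) _; first by rewrite cS'.
rewrite cS' ler_pM // ?divr_ge0 //.
have s0 : (0 < s)%N by case/andP: sn.
have [_ luv _] := rank_bounds beta kn s0.
rewrite natrB //; have := @upper_rank_lt R beta n k s;
  have := @lower_rank_ge R beta n k s.
rewrite -/iu -/iv -/th -/g; lra.
Qed.

(** The minimum of [th] and [1 - th]: up to lower-order terms, the fraction of new elements compared
    with both pivots. *)
Definition pivot_share : R := if th < 2^-1 then th else 1 - th.

Lemma avg_second_comparisons :
  avg (draws S' s) (fun S => #|if th < 2^-1 then strip x S 0 iv (S' :\: S)
                              else strip x S iu s.+1 (S' :\: S)|%:R)
    <= (N - s)%:R * pivot_share + r ^+ 2 * (g + 1).
Proof.
have g0 : 0 <= g by exact: gap_ge0.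
(* The main term loses the factor [s / (s + 1) <= 1]; the error term [g + 1] is multiplied by a
   ratio of at most [r^2]. *)
have main (mu m : R) : 0 <= mu -> m <= mu * s%:R + (g + 1) ->
    (N - s)%:R / s.+1%:R * m <= (N - s)%:R * mu + r ^+ 2 * (g + 1).
  move=> mu0 mle; apply: le_trans (ler_wpM2l _ mle) _; first by rewrite divr_ge0.
  rewrite mulrDr lerD //; last by rewrite ler_wpM2r // addr_ge0.
  rewrite mulrAC mulrA ler_pdivrMr ?ltr0n //
    -mulrA [X in _ <= X]mulrAC -[X in _ <= X]mulrA.
  by rewrite ler_wpM2l // mulrC ler_wpM2r // ler_nat.
rewrite /pivot_share; case: ifP => _.
  apply: le_trans (avg_strip_outside x R 0 iv _) _; first by rewrite cS'.
  rewrite cS' subn0; apply: main; first exact: theta_ge0.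
  have := @upper_rank_lt R beta n k s; rewrite -/iv -/th -/g; lra.
apply: le_trans (avg_strip_outside x R iu s.+1 _) _; first by rewrite cS'.
rewrite cS'; apply: main; first by rewrite subr_ge0 theta_le1 //; case/andP: kn.
rewrite natrB; last by have := iub; lia.
have := @lower_rank_ge R beta n k s; rewrite -/iu -/th -/g -natr1; lra.
Qed.

End Stage.

(** * Cost of the algorithm *)

Section Costs.
Variable R : realType.

(** The postcondition gives access to the bound on the continuation, and nonnegative weights make
    the expectation monotone; both are used in [costs_bind]. *)
Definition costs (X : Type) (P : pred X) (m : rcomp R X) (c : R) : Prop :=
  [/\ surely P m, all (fun p => 0 <= p.1.1) m & expected_comparisons m <= c].

Lemma costs_le X (P : pred X) m c c' : c <= c' -> costs P m c -> costs P m c'.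
Proof. by move=> cc [Pm m0 mc]; split=> //; exact: le_trans cc. Qed.

Lemma costs_ret X (P : pred X) a : P a -> costs P (ret R a) 0.
Proof.
move=> Pa; split; first exact: surely_ret.
- by rewrite /= ler01.
- by rewrite /expected_comparisons big_seq1 mulr0.
Qed.

Lemma expected_comparisons_bind X Y (m : rcomp R X) (g : X -> rcomp R Y) :
  expected_comparisons (bind m g) =
  \sum_(p <- m) p.1.1 * (p.1.2%:R * total_prob (g p.2) + expected_comparisons (g
    p.2)).
Proof.
rewrite /expected_comparisons big_allpairs_dep /=; apply: eq_bigr => p _.
rewrite /total_prob mulr_sumr -big_split mulr_sumr; apply: eq_bigr => q _ /=.
by rewrite natrD; ring.
Qed.

Lemma bind_ge0 X Y (m : rcomp R X) (g : X -> rcomp R Y) :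
  all (fun p => 0 <= p.1.1) m ->
  all (fun p => all (fun q => 0 <= q.1.1) (g p.2)) m ->
  all (fun p => 0 <= p.1.1) (bind m g).
Proof.
elim: m => //= p m IH /andP[p0 m0] /andP[g0 gm0].
rewrite /bind allpairs_cons all_cat IH // andbT all_map.
by apply: sub_all g0 => q q0 /=; rewrite mulr_ge0.
Qed.

Lemma costs_bind X Y (P : pred X) (Q : pred Y) m (g : X -> rcomp R Y) c c' :
  costs P m c -> (forall a, P a -> costs Q (g a) c') -> costs Q (bind m g) (c + c').
Proof.
move=> [Pm m0 mc] gQ; split.
- by apply: (surely_bind Pm) => a /gQ[].
- by apply: bind_ge0 => //; apply: sub_all Pm.2 => p /gQ[].
rewrite expected_comparisons_bind; apply: le_trans (lerD mc (lexx c')).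
have -> : c' = total_prob m * c' by rewrite Pm.1 mul1r.
rewrite /expected_comparisons /total_prob mulr_suml -big_split /=.
case: Pm => _; elim: m m0 {mc} => [|p m IH] /=; first by rewrite !big_nil.
move=> /andP[p0 m0] /andP[/gQ[[gp _] _ gc] Pm]; rewrite !big_cons lerD ?IH //.
by rewrite -/(total_prob (g p.2)) gp mulr1 mulrDr lerD2l ler_wpM2l.
Qed.

Lemma costs_compare_bind Y (Q : pred Y) k (g : unit -> rcomp R Y) c :
  costs Q (g tt) c -> costs Q (bind (compare R k) g) (k%:R + c).
Proof.
move=> gc; apply: (costs_bind (P := xpredT)) => [|[] _ //]; split.
- exact: surely_compare.
- by rewrite /= ler01.
- by rewrite /expected_comparisons big_seq1 mul1r.
Qed.

(** In contrast to [costs_bind], the bound may depend on the outcome, which allows the costs to be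
    averaged over the samples later. *)
Lemma costs_draw_bind (X : finType) Y (Q : pred Y) (F : {set X})
    (g : X -> rcomp R Y) (c : X -> R) : F != set0 ->
  (forall a, a \in F -> costs Q (g a) (c a)) -> costs Q (bind (draw R F) g) (avg F c).
Proof.
move=> F0 gc; split.
- by apply: (surely_bind (surely_draw R F0)) => a /gc[].
- apply: bind_ge0; first by rewrite all_map; apply/allP => a _ /=; rewrite invr_ge0.
  by rewrite all_map; apply/allP => a; rewrite mem_enum => /gc[].
rewrite expected_comparisons_bind big_map big_enum /= /avg mulr_sumr.
apply: ler_sum => a /gc[_ _ ac].
by rewrite mul0r add0r ler_wpM2l ?invr_ge0.
Qed.

End Costs.

(** * Comparisons made in the rounds *)

Section Rounds.
Variables (R : realType) (r beta : R).
Hypothesis r1 : 1 < r.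
Hypothesis hbeta : 1 / 4 * (1 - r^-1) ^- 2 <= beta.
Variables (I : finType) (d : Order.disp_t) (T : orderType d) (x : I -> T).
Variables (rec : {set I} -> nat -> rcomp R I) (a : R).
Hypothesis a0 : 0 <= a.
Implicit Types (A B S : {set I}) (u v : I).

(** At most one of L, M and R is searched. M is always charged, L and R only when the rank falls
    into them. *)
Lemma costs_update S S' (u v : I) iu iv i : S \subset S' ->
    (0 < iu <= iv)%N -> kth_smallest x S iu u -> kth_smallest x S iv v ->
    (0 < i <= #|S'|)%N ->
    (forall B j, B \proper S' -> (0 < j <= #|B|)%N ->
       costs (kth_smallest x B j) (rec B j) (a * #|B|%:R)) ->
  costs (kth_smallest x S' i) (update x rec S' u v i)
    (a * (#|strip x S iu iv S'|%:R +
      #|strip x S 0 iu S'|%:R * (i <= #|strip x S 0 iu S'|)%N%:R +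
      #|strip x S iv #|S|.+1 S'|%:R *
        (#|S'| - #|strip x S iv #|S|.+1 S'| < i)%N%:R)).
Proof.
move=> SS' /andP[iu0 iuv] uk vk /andP[i0 iS'] recP.
have iv0 : (0 < iv)%N by exact: leq_trans iuv.
have uS' : u \in S' by apply: (subsetP SS'); case/and3P: uk.
have vS' : v \in S' by apply: (subsetP SS'); case/and3P: vk.
have uv : (x u <= x v)%O by exact: kth_smallest_le iuv uk vk.
have correct : surely (kth_smallest x S' i) (update x rec S' u v i).
  by apply: update_correct => // [|B j BS' jB];
    [rewrite i0 | case: (recP B j BS' jB)].
suff : all (fun p => 0 <= p.1.1) (update x rec S' u v i) /\
       expected_comparisons (update x rec S' u v i) <=
    (a * (#|strip x S iu iv S'|%:R +
      #|strip x S 0 iu S'|%:R * (i <= #|strip x S 0 iu S'|)%N%:R +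
      #|strip x S iv #|S|.+1 S'|%:R *
        (#|S'| - #|strip x S iv #|S|.+1 S'| < i)%N%:R)) by case; split.
have LE : strip x S 0 iu S' = [set j in S' | (x j < x u)%O].
  by apply/setP => j; rewrite !inE (kth_smallest_ltl j iu0 uk).
have VE : strip x S iv #|S|.+1 S' = [set j in S' | (x v < x j)%O].
  by apply/setP => j; rewrite !inE (kth_smallest_ltr j iv0 vk) ltnS le_count_max
    andbT.
have ME : strip x S iu iv S' = [set j in S' | (x u < x j < x v)%O].
  by apply/setP => j; rewrite !inE (kth_smallest_ltl j iv0 vk) (kth_smallest_ltr j
    iu0 uk).
rewrite /update -LE -VE -ME.
set L := strip x S 0 iu S'; set V := strip x S iv #|S|.+1 S';
  set M := strip x S iu iv S'.
set U := [set j in S' | x j == x u].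
set c := a * (#|M|%:R + _ + _).
have c0 : 0 <= c by rewrite mulr_ge0 // !addr_ge0 // mulr_ge0.
have ret_ok w : all (fun p => 0 <=
  p.1.1) (ret R w) /\ expected_comparisons (ret R w) <= c.
  by rewrite /= ler01 /expected_comparisons big_seq1 mulr0.
have rec_ok B j w : w \in S' -> w \notin B -> B \subset S' -> (0 < j <= #|B|)%N ->
    a * #|B|%:R <= c ->
    all (fun p => 0 <= p.1.1) (rec B j) /\ expected_comparisons (rec B j) <= c.
  move=> wS' wB BS' jB Bc.
  have pB : B \proper S' by apply/properP; split => //; exists w.
  by case: (recP B j pB jB) => _ ? ?; split => //; exact: le_trans Bc.
have sub P : [set j in S' | P j] \subset S' by apply/subsetP => j;
  rewrite inE => /andP[].
case: ifPn => [_|NU]; first exact: ret_ok.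
case: ifPn => [_|NV]; first exact: ret_ok.
case: ifPn => [iL|iL].
  apply: (rec_ok _ _ u) => //; rewrite ?i0 // ?sub //.
    by rewrite /L LE inE ltxx andbF.
  by rewrite ler_wpM2l // iL mulr1 -addrA addrCA lerDl addr_ge0 // mulr_ge0.
have VS' : (#|V| <= #|S'|)%N by exact/subset_leq_card/sub.
case: ifPn => [iV|iV].
  apply: (rec_ok _ _ v) => //; rewrite ?sub //.
  - by rewrite /V VE inE ltxx andbF.
  - by apply/andP; split; lia.
  by rewrite ler_wpM2l // iV mulr1 lerDr addr_ge0 // mulr_ge0.
have iM := (leq_card_setU (L :|: U) M).1.
apply: (rec_ok _ _ u) => //; rewrite ?sub //.
- by rewrite /M ME inE ltxx andbF.
- have LUi : (#|L :|: U| < i)%N by rewrite -ltnNge in iL; rewrite iL /= -ltnNge in NU.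
  have : (i <= #|L :|: U :|: M|)%N.
    by rewrite -leqNgt in iV; rewrite iV andbT -leqNgt in NV.
  by lia.
by rewrite ler_wpM2l // -addrA lerDl addr_ge0 // mulr_ge0.
Qed.

Definition second_compared n k S S' :=
  if theta R n k < 2^-1 then strip x S 0 (upper_rank beta n k #|S|) (S' :\: S)
  else strip x S (lower_rank beta n k #|S|) #|S|.+1 (S' :\: S).

(* The rank of the new [u] is at most that of the new [v], so [L] is searched for
   one of them only if it is searched for [u], and [V] only if it is for [v]. *)
Definition stage_cost n k S S' : R :=
  let L := strip x S 0 (lower_rank beta n k #|S|) S' in
  let M := strip x S (lower_rank beta n k #|S|) (upper_rank beta n k #|S|) S' in
  let V := strip x S (upper_rank beta n k #|S|) #|S|.+1 S' in
  #|S' :\: S|%:R + #|second_compared n k S S'|%:R +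
  2 * a * (#|M|%:R + #|L|%:R * (lower_rank beta n k #|S'| <= #|L|)%N%:R +
           #|V|%:R * (#|S'| - #|V| < upper_rank beta n k #|S'|)%N%:R).

(** The recursion of [rounds] with the pivots eliminated: the cost depends on the samples alone, so
    the order of drawing can be exchanged. *)
Fixpoint rounds_cost A k fuel S : R :=
  if fuel is fuel'.+1 then
    avg (extensions S A (next_size r #|A| #|S|)) (fun S' =>
      stage_cost #|A| k S S' +
      if #|S'| == #|A| then 0 else rounds_cost A k fuel' S')
  else 0.

Lemma sum_locate_cost n k S S' (u v : I) : (0 < k <= n)%N -> (0 < #|S|)%N ->
    kth_smallest x S (lower_rank beta n k #|S|) u ->
    kth_smallest x S (upper_rank beta n k #|S|) v ->
  (\sum_(j in S' :\: S) locate_cost x (theta R n k) u v j)%N =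
  (#|S' :\: S| + #|second_compared n k S S'|)%N.
Proof.
move=> kn S0 uk vk; have [lo lh hi] := rank_bounds beta kn S0.
rewrite /second_compared /locate_cost -[X in (X + _)%N]sum1_card.
case: (_ < 2^-1); rewrite /strip -sum1dep_card big_mkcondr -big_split;
  apply: eq_bigr => j _ /=.
  by rewrite (kth_smallest_ltl j (leq_trans lo lh) vk); case: ifP.
by rewrite (kth_smallest_ltr j lo uk) ltnS le_count_max andbT; case: ifP.
Qed.

Lemma costs_rounds fuel A S k (u v : I) :
    (0 < k <= #|A|)%N -> S \subset A -> (0 < #|S| < #|A|)%N ->
    (#|A| <= fuel + #|S|)%N ->
    kth_smallest x S (lower_rank beta #|A| k #|S|) u ->
    kth_smallest x S (upper_rank beta #|A| k #|S|) v ->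
    (forall B j, B \proper A -> (0 < j <= #|B|)%N ->
       costs (kth_smallest x B j) (rec B j) (a * #|B|%:R)) ->
  costs (kth_smallest x A k) (rounds r beta x rec fuel A k S u v)
    (rounds_cost A k fuel S).
Proof.
move=> kA + + + + + recP; have /andP[k0 kn] := kA.
elim: fuel S u v => [|fuel IH] S u v SA /andP[S0 SltA] Af uk vk /=.
  by rewrite leqNgt SltA in Af.
have /andP[lt_next le_next] := next_size_bounds r1 (introT andP (conj S0 SltA)).
apply: costs_draw_bind.
  by rewrite -card_gt0 card_extensions ?bin_gt0 ?leq_sub2r // ltnW.
move=> S'; rewrite inE => /and3P[SS' S'A /eqP cS'].
have S'0 : (0 < #|S'|)%N by rewrite cS' (leq_trans _ lt_next).
have [lo lh hi] := rank_bounds beta kA S'0.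
have [lo' lh' hi'] := rank_bounds beta kA S0.
rewrite (sum_locate_cost S' kA S0 uk vk).
have recS' B j : B \proper S' -> (0 < j <= #|B|)%N ->
    costs (kth_smallest x B j) (rec B j) (a * #|B|%:R).
  by move=> BS'; apply: recP; exact: proper_sub_trans S'A.
set tail := if _ then 0 else _.
apply: costs_le; last first.
  apply: costs_compare_bind.
  apply: costs_bind.
    apply: (costs_update SS' _ uk vk _ recS'); first by rewrite lo' lh'.
    by rewrite lo (leq_trans lh).
  move=> u' u'k; apply: (costs_bind (c' := tail)).
    apply: (costs_update SS' _ uk vk _ recS'); first by rewrite lo' lh'.
    by rewrite hi (leq_trans lo).
  move=> v' v'k; rewrite /tail; case: ifPn => [/eqP S'n|S'n].
    have S'E : S' = A by apply/eqP; rewrite eqEcard S'A S'n /=.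
    apply: costs_ret; move: u'k; rewrite S'E lower_rank_last //.
    exact: leq_trans kn.
  apply: IH => //; first by rewrite S'0 ltn_neqAle S'n subset_leq_card.
  by apply: leq_trans Af _; rewrite addSnnS leq_add2l cS'.
rewrite /stage_cost.
set L := strip x S 0 _ S'; set V := strip x S _ #|S|.+1 S'; set M := strip x S _ _ S'.
rewrite !addrA lerD2r natrD -!addrA !lerD2l -mulrDr [2 * a]mulrC -mulrA.
rewrite ler_wpM2l //.
have lv : (#|S'| - #|V| < lower_rank beta #|A| k #|S'|)%N%:R <=
          (#|S'| - #|V| < upper_rank beta #|A| k #|S'|)%N%:R :> R.
  by rewrite ler_nat; case: ltnP => // /leq_trans ->.
have ul : (upper_rank beta #|A| k #|S'| <= #|L|)%N%:R <=
          (lower_rank beta #|A| k #|S'| <= #|L|)%N%:R :> R.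
  case: (boolP (upper_rank _ _ _ _ <= _)%N) => [h|_]; last exact: ler0n.
  by rewrite (leq_trans lh h).
have := ler_wpM2l (ler0n R #|V|) lv; have := ler_wpM2l (ler0n R #|L|) ul.
lra.
Qed.

End Rounds.

(** * Summation over the rounds *)

Section Bound.
Variables (R : realType) (alpha r beta : R).
Hypothesis alpha01 : 0 < alpha <= 1 / 2.
Hypothesis r1 : 1 < r.
Hypothesis hbeta : 1 / 4 * (1 - r^-1) ^- 2 <= beta.

(** For [n >= 2] the factor [c sqrt (ln n)] is at least 1, so constants and [sqrt s] are absorbed
    into multiples of [sqrt (s ln n)]. *)
Let c : R := (Num.sqrt (ln 2))^-1.
Let b : R := Num.sqrt beta.

Let ln2 : 0 < ln 2 :> R. Proof. by rewrite ln_gt0 // ltr1n. Qed.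
Let c0 : 0 < c. Proof. by rewrite invr_gt0 sqrtr_gt0. Qed.
Let r21 : 0 <= r ^+ 2 + 1. Proof. by rewrite addr_ge0 ?sqr_ge0. Qed.

Let log_ge1 n : (1 < n)%N -> 1 <= c * Num.sqrt (ln n%:R).
Proof.
move=> n1; rewrite ler_pdivlMl ?sqrtr_gt0 // mulr1 ler_wsqrtr //
  ler_ln ?posrE ?ltr0n //.
  by rewrite ler_nat.
by lia.
Qed.

Definition pivot_cost : R := r ^+ 2 * (b + c).
(** In units of [sqrt (s ln n)], M contributes [2 b + c] and L and R contribute [2 c] each; the
    factor 2 is for the two pivots. *)
Definition recursion_cost : R := 2 * (r ^+ 2 + 1) * (2 * b + 5 * c).
Definition round_cost (a : R) : R := pivot_cost + a * recursion_cost.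

Lemma pivot_cost_ge0 : 0 <= pivot_cost.
Proof. by rewrite mulr_ge0 ?sqr_ge0 // addr_ge0 ?sqrtr_ge0 // ltW. Qed.

Lemma recursion_cost_gt0 : 0 < recursion_cost.
Proof.
rewrite mulr_gt0 ?mulr_gt0 // ?ltr_wpDl ?sqr_ge0 ?mulr_ge0 ?sqrtr_ge0 //.
exact: mulr_gt0.
Qed.

Section Rounds.
Variables (I : finType) (d : Order.disp_t) (T : orderType d) (x : I -> T).
Variables (a : R).
Hypothesis a0 : 0 <= a.
Implicit Types (A B S : {set I}).

Let round_cost0 : 0 <= round_cost a.
Proof. by rewrite addr_ge0 ?pivot_cost_ge0 // mulr_ge0 // ltW //
  recursion_cost_gt0. Qed.

Lemma avg_stage_cost n k s S' : (0 < k <= n)%N -> (0 < s < n)%N ->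
    #|S'| = next_size r n s ->
  avg (draws S' s) (fun S => stage_cost beta x a n k S S') <=
  (#|S'| - s)%:R * (1 + pivot_share R n k) +
    round_cost a * (Num.sqrt s%:R * Num.sqrt (ln n%:R)).
Proof.
move=> kn sn cS'.
have := avg_second_comparisons r1 hbeta x kn sn cS'.
have := avg_middle beta r1 x kn sn cS'.
have := avg_above_failure r1 hbeta x kn sn cS'.
have := avg_below_failure r1 hbeta x kn sn cS'.
set iu := lower_rank _ _ _ _; set iv := upper_rank _ _ _ _.
set iu' := lower_rank _ _ _ _; set iv' := upper_rank _ _ _ _.
set N := next_size r n s in cS' iu' iv' *.
set mu := pivot_share _ _ _.
move=> bL bV bM b2.
set EL := avg _ _ in bL; set EV := avg _ _ in bV.
set EM := avg _ _ in bM; set E2 := avg _ _ in b2.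
have /andP[sN _] := next_size_bounds r1 sn; rewrite -/N in sN.
case/andP: (sn) => s0 sn'.
have SN0 : draws S' s != set0 by apply: draws_neq0; rewrite cS' ltnW.
have -> : avg (draws S' s) (fun S => stage_cost beta x a n k S S') =
    (N - s)%:R + E2 + 2 * a * (EM + EL + EV).
  rewrite /E2 /EM /EL /EV -!avgD -avgZ -[(N - s)%:R](avg_const _ SN0) -!avgD;
    apply: eq_avg => S; rewrite inE => /andP[SS' /eqP cS].
  by rewrite /stage_cost /second_compared cS cS' cardsDS // cS cS'.
rewrite cS'.
set h := Num.sqrt s%:R * _.
have n1 : (1 < n)%N by exact: leq_ltn_trans s0 sn'.
have nR : 0 < n%:R :> R by rewrite ltr0n ltnW.
have sR : 1 <= Num.sqrt s%:R :> R by rewrite -[X in X <= _]sqrtr1 ler_wsqrtr // ler1n.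
have sh : Num.sqrt s%:R <= c * h.
  by rewrite /h mulrCA ler_peMr ?sqrtr_ge0 // log_ge1.
have h1 : 1 <= c * h by exact: le_trans sh.
(* This is why a failure probability of [n^(-1/2)] suffices: [N <= (r^2 + 1) s] and [s <= n]. *)
have hN : N%:R / Num.sqrt n%:R <= (r ^+ 2 + 1) * Num.sqrt s%:R.
  rewrite ler_pdivrMr ?sqrtr_gt0 //.
  apply: le_trans (next_size_le r n s) _.
  apply: le_trans (_ : (r ^+ 2 + 1) * s%:R <= _).
    by rewrite mulrDl lerD2l mul1r ler1n.
  rewrite -mulrA ler_wpM2l // -[X in X <= _](@sqr_sqrtr R s%:R) // expr2.
  by rewrite ler_wpM2l ?sqrtr_ge0 // ler_wsqrtr // ler_nat ltnW.
rewrite (gapE r1 hbeta sn') -/b -/h in bM b2.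
rewrite -addrA [X in _ <= X + _]mulrDr mulr1 -[X in _ <= X]addrA lerD2l.
have u1 : E2 <= (N - s)%:R * mu + pivot_cost * h.
  apply: le_trans b2 _; rewrite lerD2l /pivot_cost -mulrA ler_wpM2l ?sqr_ge0 //.
  by rewrite mulrDl lerD2l.
have u2 : 2 * (EM + EL + EV) <= recursion_cost * h.
  apply: le_trans (_ : 2 * (r ^+ 2 + 1) * ((2 * b + 5 * c) * h) <= _);
    last by rewrite !mulrA.
  rewrite -mulrA ler_wpM2l //.
  apply: le_trans (_ : (r ^+ 2 + 1) * (2 * (b * h) + 1 + (1 + Num.sqrt s%:R) + (1 +
    Num.sqrt s%:R)) <= _).
    lra.
  by rewrite ler_wpM2l //; lra.
have := ler_wpM2l a0 u2; rewrite /round_cost; lra.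
Qed.

(** The bound is a potential: a round before the last pays its error [sqrt s] by the growth of
    [sqrt s / (r - 1)]. The summand 1 in the coefficient of [sqrt n] pays for the last round, whose
    sample may be truncated. *)
Lemma avg_rounds_cost A k fuel s : (0 < k <= #|A|)%N -> (0 < s < #|A|)%N ->
  avg (draws A s) (rounds_cost r beta x a A k fuel) <=
  (#|A| - s)%:R * (1 + pivot_share R #|A| k) +
    round_cost a * ((1 + (r - 1)^-1) * Num.sqrt #|A|%:R - (r - 1)^-1 * Num.sqrt s%:R)
      * Num.sqrt (ln #|A|%:R).
Proof.
move=> kA; set n := #|A|; set w := Num.sqrt (ln _); set mu := pivot_share _ _ _.
set q := (r - 1)^-1.
have q0 : 0 <= q by rewrite invr_ge0 subr_ge0 ltW.
have w0 : 0 <= w by exact: sqrtr_ge0.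
have mu0 : 0 <= mu.
  rewrite /mu /pivot_share; case: ifP => _; first exact: theta_ge0.
  by rewrite subr_ge0 theta_le1 //; case/andP: kA.
elim: fuel s => [|fuel IH] s sn; have /andP[s0 sltn] := sn.
  have sq : Num.sqrt s%:R <= Num.sqrt n%:R :> R by rewrite ler_wsqrtr // ler_nat ltnW.
  rewrite avg_const ?draws_neq0 1?ltnW // addr_ge0 //.
    by rewrite mulr_ge0 // addr_ge0.
  rewrite !mulr_ge0 // mulrDl mul1r -addrA -mulrBr addr_ge0 ?sqrtr_ge0 // mulr_ge0 //.
  by rewrite subr_ge0.
have /andP[sN Nn] := next_size_bounds r1 sn.
set N := next_size r n s in sN Nn.
pose rest S' := if #|S'| == n then 0 else rounds_cost r beta x a A k fuel S'.
(* The later rounds depend on [S'] only, so after the exchange just the cost of this round is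
   averaged over [S]. *)
have -> : avg (draws A s) (rounds_cost r beta x a A k fuel.+1) =
    avg (draws A N) (fun S' => avg (draws S' s) (fun S =>
      stage_cost beta x a n k S S') + rest S').
  transitivity (avg (draws A s) (fun S => avg (extensions S A N)
      (fun S' => stage_cost beta x a n k S S' + rest S'))).
    by apply: eq_avg => S; rewrite inE => /andP[_ /eqP cS] /=; rewrite cS.
  rewrite avg_draws_exchange ?(ltnW sN) //.
  apply: eq_avg => S'; rewrite inE => /andP[_ /eqP cS'].
  by rewrite avgD avg_const // draws_neq0 // cS' ltnW.
rewrite avgD.
have stage : avg (draws A N) (fun S' => avg (draws S' s) (fun S =>
      stage_cost beta x a n k S S')) <=
    (N - s)%:R * (1 + mu) + round_cost a * (Num.sqrt s%:R * w).
  have AN0 : draws A N != set0 by exact: draws_neq0.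
  rewrite -[X in _ <= X](avg_const _ AN0); apply: le_avg => S'.
  rewrite inE => /andP[_ /eqP cS'].
  by apply: le_trans (avg_stage_cost kA sn cS') _; rewrite cS'.
apply: le_trans (lerD stage (lexx _)) _.
have nsE : (n - s)%:R = (n - N)%:R + (N - s)%:R :> R by rewrite -natrD addnBA
  ?subnK // ltnW.
have sqs : 0 <= Num.sqrt s%:R :> R by exact: sqrtr_ge0.
have sqn : Num.sqrt s%:R <= Num.sqrt n%:R :> R by rewrite ler_wsqrtr // ler_nat ltnW.
have [NEn|Nn'] := eqVneq N n.
  have -> : avg (draws A N) rest = 0.
    rewrite (eq_avg (psi := fun=> 0)); first by rewrite avg_const // draws_neq0.
    by move=> S'; rewrite inE /rest => /andP[_ /eqP ->]; rewrite NEn eqxx.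
  rewrite addr0 NEn lerD2l -mulrA ler_wpM2l // ler_wpM2r //.
  rewrite mulrDl mul1r -addrA -mulrBr;
    have := mulr_ge0 q0 (_ : 0 <= Num.sqrt n%:R - Num.sqrt s%:R).
  rewrite subr_ge0 => /(_ sqn); lra.
have Nltn : (N < n)%N by rewrite ltn_neqAle Nn'.
have -> : avg (draws A N) rest = avg (draws A N) (rounds_cost r beta x a A k fuel).
  by apply: eq_avg => S'; rewrite inE /rest => /andP[_ /eqP ->]; rewrite (negPf Nn').
have N0 : (0 < N < #|A|)%N by rewrite Nltn andbT; exact: ltn_trans sN.
apply: le_trans (lerD (lexx _) (IH N N0)) _.
(* Equivalent to [r sqrt s <= sqrt N], the geometric growth of the errors. *)
have key : Num.sqrt s%:R <= q * (Num.sqrt N%:R - Num.sqrt s%:R).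
  have rs : r * Num.sqrt s%:R <= Num.sqrt N%:R.
    rewrite -[r]gtr0_norm ?(lt_trans ltr01 r1) // -sqrtr_sqr -sqrtrM ?sqr_ge0 //.
    by rewrite ler_wsqrtr // next_size_ge.
  by rewrite ler_pdivlMl ?subr_gt0 //; lra.
have := ler_wpM2l (mulr_ge0 round_cost0 w0) key.
rewrite nsE; lra.
Qed.

Variable rec : {set I} -> nat -> rcomp R I.

Lemma costs_select_body A k : (1 < #|A|)%N -> (0 < k <= #|A|)%N ->
    (forall B j, B \proper A -> (0 < j <= #|B|)%N ->
       costs (kth_smallest x B j) (rec B j) (a * #|B|%:R)) ->
  costs (kth_smallest x A k) (select_body alpha r beta x rec A k)
    (#|A|%:R * (1 + pivot_share R #|A| k) +
     (round_cost a * (1 + (r - 1)^-1) + 2 * a * c) * f #|A|%:R).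
Proof.
move=> A1 kA recP; set n := #|A|.
have /andP[s0 sA] := first_size_bounds alpha01 A1.
set s := first_size alpha #|A| in s0 sA.
have E : select_body alpha r beta x rec A k =
   (S <~ draw R [set S : {set I} | (S \subset A) && (#|S| == s)] ;;
    u <~ rec S (lower_rank beta #|A| k #|S|) ;;
    v <~ rec S (upper_rank beta #|A| k #|S|) ;;
    rounds r beta x rec #|A| A k S u v).
  rewrite /select_body; case eA: (enum A) => [|j [|]] //.
  by move: A1; rewrite cardE eA.
rewrite E; apply: costs_le (_ : avg (draws A s) (fun S =>
    a * s%:R + (a * s%:R + rounds_cost r beta x a A k n S)) <= _) _; last first.
  apply: costs_draw_bind; first by apply: draws_neq0; exact: ltnW.
  move=> S; rewrite inE => /andP[SA /eqP cS]; rewrite -cS in s0 sA *.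
  have pS : S \proper A by rewrite properEcard SA.
  have [lo lh hi] := rank_bounds beta kA s0.
  apply: costs_bind; first by apply: recP => //; rewrite lo (leq_trans lh).
  move=> u uk; apply: costs_bind; first by apply: recP => //;
    rewrite hi (leq_trans lo).
  move=> v vk; apply: costs_rounds => //; last by rewrite leq_addr.
  by rewrite s0.
have sn : (0 < s < #|A|)%N by rewrite s0.
rewrite !avgD !avg_const ?draws_neq0 1?ltnW //.
have nR : 0 < n%:R :> R by rewrite ltr0n ltnW.
have fE : f n%:R = Num.sqrt n%:R * Num.sqrt (ln n%:R) :> R by rewrite /f sqrtrM.
(* By [alpha <= 1/2] the two calls on the first sample cost [O(sqrt n)]. *)
have ssq : s%:R <= Num.sqrt n%:R :> R.
  apply: le_trans (_ : n%:R `^ alpha <= _).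
    by rewrite /s /first_size truncn_le // powR_ge0.
  rewrite -powR12_sqrt // ler_powR ?ler1n ?(ltnW A1) //.
  by case/andP: alpha01 => _; rewrite mul1r.
have sf : s%:R <= c * f n%:R :> R.
  apply: le_trans ssq _; rewrite fE mulrCA ler_peMr ?sqrtr_ge0 //.
  exact: log_ge1.
have q0 : 0 <= (r - 1)^-1 by rewrite invr_ge0 subr_ge0 ltW.
have w0 : 0 <= Num.sqrt (ln n%:R) :> R by exact: sqrtr_ge0.
have mu0 : 0 <= pivot_share R n k.
  rewrite /pivot_share; case: ifP => _; first exact: theta_ge0.
  by rewrite subr_ge0 theta_le1 //; case/andP: kA.
apply: le_trans (lerD (lexx _) (lerD (lexx _) (avg_rounds_cost n kA sn))) _.
rewrite -/n.
have u1 : (n - s)%:R * (1 + pivot_share R n k) <= n%:R * (1 + pivot_share R n k).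
  by rewrite ler_wpM2r ?addr_ge0 // ler_nat leq_subr.
have u2 : round_cost a * ((1 + (r - 1)^-1) * Num.sqrt n%:R - (r - 1)^-1 * Num.sqrt
  s%:R)
      * Num.sqrt (ln n%:R) <= round_cost a * (1 + (r - 1)^-1) * f n%:R.
  rewrite fE -!mulrA ler_wpM2l // mulrA ler_wpM2r // gerBl.
  by rewrite mulr_ge0 // sqrtr_ge0.
have := ler_wpM2l a0 sf; lra.
Qed.

End Rounds.

End Bound.

(** * Growth of the main and error terms *)

Lemma pivot_shareE (R : realType) n k : (0 < k <= n)%N ->
  n%:R * pivot_share R n k = (minn k (n - k))%:R.
Proof.
move=> /andP[k0 kn]; have n0 : 0 < n%:R :> R by rewrite ltr0n (leq_trans k0).
rewrite /pivot_share /theta.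
have -> : (k%:R / n%:R < 2^-1 :> R) = (k * 2 < n)%N.
  by rewrite ltr_pdivrMr // mulrC ltr_pdivlMr // -natrM ltr_nat.
case: ifP => h; first by rewrite mulrC divfK ?gt_eqF // (minn_idPl _) //; lia.
by rewrite mulrBr mulr1 mulrC divfK ?gt_eqF // (minn_idPr _) ?natrB //; lia.
Qed.

(** From [ln n <= 2 sqrt n] follows [f(n)^2 <= 2 n^(3/2)], which is at most [e^2 n^2] once
    [sqrt n >= 2 / e^2]. *)
Lemma f_le_linear (R : realType) (e : R) n : 0 < e -> 4 / e ^+ 4 <= n%:R ->
  f n%:R <= e * n%:R.
Proof.
move=> e0 hn; have n0 : 0 < n%:R :> R.
  by apply: lt_le_trans hn; rewrite divr_gt0 // exprn_gt0.
pose y := Num.sqrt n%:R : R.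
have y0 : 0 < y by rewrite sqrtr_gt0.
have yE : n%:R = y ^+ 2 by rewrite sqr_sqrtr // ltW.
have lny : ln n%:R <= 2 * y.
  rewrite yE lnXn // -[_ *+ _]mulr_natl ler_pM2l //.
  exact/ltW/ln_sublinear.
have ey : 2 <= e ^+ 2 * y.
  rewrite -ler_sqr ?nnegrE ?(mulr_ge0 (sqr_ge0 e) (ltW y0)) //.
  move: hn; rewrite yE ler_pdivrMr ?exprn_gt0 // => hn.
  by rewrite exprMn -exprM; lra.
have en0 : 0 <= e * n%:R by rewrite mulr_ge0 // ltW.
rewrite /f -[X in _ <= X](ger0_norm en0) -sqrtr_sqr ler_wsqrtr //.
apply: le_trans (ler_wpM2l (ltW n0) lny) _; rewrite yE exprMn.
have := ler_wpM2r (_ : 0 <= y ^+ 3) ey; rewrite exprn_ge0 ?(ltW y0) // => /(_ isT).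
by congr (_ <= _); ring.
Qed.

Lemma f_le (R : realType) n : (0 < n)%N -> f n%:R <= n%:R :> R.
Proof.
move=> n0; have nR : 0 < n%:R :> R by rewrite ltr0n.
rewrite /f -[X in _ <= X](ger0_norm (ltW nR)) -sqrtr_sqr ler_wsqrtr //
  expr2 ler_wpM2l //.
exact/ltW/ln_sublinear.
Qed.

(** * Induction on the number of elements *)

Section Induction.
Variables (R : realType) (alpha r beta : R).
Hypothesis alpha01 : 0 < alpha <= 1 / 2.
Hypothesis r1 : 1 < r.
Hypothesis hbeta : 1 / 4 * (1 - r^-1) ^- 2 <= beta.

(** The input type and family are quantified inside, so that [a] does not depend on them; the fuel
    is arbitrary since recursive calls have more of it than [select] would supply. *)
Definition linear_cost (a : R) (N : nat) : Prop :=
  forall (I : finType) (d : Order.disp_t) (T : orderType d) (x : I -> T)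
    fuel (B : {set I}) k, (#|B| <= N)%N -> (#|B| <= fuel)%N -> (0 < k <= #|B|)%N ->
  costs (kth_smallest x B k) (select_fuel alpha r beta x fuel B k) (a * #|B|%:R).

(** [C1 + a * C2] is the coefficient of [f] in [costs_select_body], split into the part free of [a]
    and the part linear in [a]. *)
Let C1 : R := pivot_cost r beta * (1 + (r - 1)^-1).
Let C2 : R := recursion_cost r beta * (1 + (r - 1)^-1) + 2 * (Num.sqrt (ln 2))^-1.

Let q0 : 0 <= (r - 1)^-1. Proof. by rewrite invr_ge0 subr_ge0 ltW. Qed.
Let C10 : 0 <= C1.
Proof. by rewrite mulr_ge0 ?pivot_cost_ge0 // addr_ge0. Qed.
Let C20 : 0 <= C2.
Proof.
apply: addr_ge0; last by rewrite mulr_ge0 // invr_ge0 sqrtr_ge0.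
by rewrite mulr_ge0 ?addr_ge0 // ltW // recursion_cost_gt0.
Qed.

Lemma f_ge0 (t : R) : 0 <= f t. Proof. exact: sqrtr_ge0. Qed.

Lemma costs_select_step (a : R) N (I : finType) (d : Order.disp_t) (T : orderType d)
    (x : I -> T) fuel (B : {set I}) k : 0 <= a -> linear_cost a N ->
    (#|B| <= N.+1)%N -> (#|B| <= fuel)%N -> (0 < k <= #|B|)%N ->
  costs (kth_smallest x B k) (select_fuel alpha r beta x fuel B k)
    (#|B|%:R + (minn k (#|B| - k))%:R + (C1 + a * C2) * f #|B|%:R).
Proof.
move=> a0 lin BN; case: fuel => [|fuel] Bf kB.
  by case/andP: kB => /leq_trans h /h; rewrite ltnNge Bf.
have [B1|B1] := leqP #|B| 1.
  have /eqP/cards1P[j Bj] : #|B| = 1%N by lia.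
  rewrite {2 3}Bj /= /select_body enum_set1.
  apply: (@costs_le _ _ _ _ 0).
    by rewrite !addr_ge0 // mulr_ge0 ?f_ge0 // addr_ge0 // mulr_ge0.
  apply: costs_ret; rewrite Bj cards1 in kB *.
  have -> : k = 1%N by lia.
  apply/and3P; split; first by rewrite inE.
    rewrite leqn0 cards_eq0; apply/eqP/setP => i; rewrite !inE.
    by case: eqP => //= ->; rewrite ltxx.
  by rewrite card_gt0; apply/set0Pn; exists j; rewrite !inE eqxx lexx.
apply: (costs_le _ (costs_select_body alpha01 r1 hbeta a0 B1 kB _)).
  rewrite mulrDr mulr1 pivot_shareE // lerD2l /round_cost /C1 /C2.
  by rewrite le_eqVlt; apply/orP; left; apply/eqP; ring.
move=> A j /proper_card AB jA; apply: lin => //.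
  by rewrite -ltnS (leq_trans AB).
by rewrite -ltnS (leq_trans AB).
Qed.

Let minn_le n k : (minn k (n - k))%:R <= n%:R :> R.
Proof. by rewrite ler_nat (leq_trans (geq_minr _ _)) // leq_subr. Qed.

(** The constant grows with [N]; this only serves sizes below a fixed threshold. *)
Lemma linear_cost_small N : exists2 a, 0 <= a & linear_cost a N.
Proof.
elim: N => [|N [a a0 lin]].
  exists 0 => // I d T x fuel B k B0 _ /andP[k0 kB].
  by have := leq_trans k0 (leq_trans kB B0).
exists (2 + (C1 + a * C2)); first by rewrite !addr_ge0 // mulr_ge0.
move=> I d T x fuel B k BN Bf kB.
apply: (costs_le _ (costs_select_step x a0 lin BN Bf kB)).
have B0 : (0 < #|B|)%N by case/andP: kB => /leq_trans; apply.
rewrite [X in _ <= X]mulrDl; apply: lerD; last first.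
  by rewrite ler_wpM2l ?f_le // addr_ge0 // mulr_ge0.
by have := minn_le #|B| k; lra.
Qed.

(** Above the threshold [f(n) <= e n] with [C2 e <= 1/2], so the recursive calls cost at most
    [a n / 2] and the rest at most [(2 + C1) n]. *)
Lemma linear_cost_large : exists2 a, 0 <= a & forall N, linear_cost a N.
Proof.
pose e := (2 * (C2 + 1))^-1.
have e0 : 0 < e by rewrite invr_gt0 mulr_gt0 // ltr_wpDl.
have C2e : C2 * e <= 2^-1.
  rewrite /e invfM mulrCA ger_pMr ?invr_gt0 // ler_pdivrMr ?ltr_wpDl // mul1r.
  by rewrite lerDl.
pose n0 := (Num.truncn (4 / e ^+ 4)).+1.
have fe n : (n0 <= n)%N -> f n%:R <= e * n%:R :> R.
  move=> n0n; apply: f_le_linear => //; apply: ltW;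
    apply: lt_le_trans (truncnS_gt _) _.
  by rewrite ler_nat.
have [a0 a00 lin0] := linear_cost_small n0.
(* The summand [a0] covers sizes up to [n0]; for larger ones [a / 2 >= 2 + C1] closes the
   induction. *)
pose a := a0 + (4 + 2 * C1).
have aP : 0 <= a by rewrite !addr_ge0 // mulr_ge0.
exists a => //; elim=> [|N IH] I d T x fuel B k BN Bf kB.
  by case/andP: kB => /leq_trans h /h; rewrite ltnNge BN.
have B0 : (0 < #|B|)%N by case/andP: kB => /leq_trans; apply.
have [Bn0|n0B] := leqP #|B| n0.
  apply: (costs_le _ (lin0 I d T x fuel B k Bn0 Bf kB)).
  by rewrite ler_wpM2r // lerDl addr_ge0 // mulr_ge0.
apply: (costs_le _ (costs_select_step x aP IH BN Bf kB)).
have u1 := ler_wpM2l C10 (f_le R B0).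
have u2 := ler_wpM2l (mulr_ge0 aP C20) (fe _ (ltnW n0B)).
have u3 := ler_wpM2l (mulr_ge0 aP (ler0n R #|B|)) C2e.
have := minn_le #|B| k; have := ler_wpM2r (ler0n R #|B|) a00.
rewrite /a in u2 u3 *; lra.
Qed.

Lemma expected_select : exists2 gamma : R, 0 < gamma &
  forall (I : finType) (d : Order.disp_t) (T : orderType d) (x : I -> T)
    (B : {set I}) k, (0 < k <= #|B|)%N ->
  expected_comparisons (select alpha r beta x B k) <=
    #|B|%:R + (minn k (#|B| - k))%:R + gamma * f #|B|%:R.
Proof.
have [a a0 lin] := linear_cost_large.
(* One more step from the linear bound gives the coefficient [C1 + a * C2]; adding 1 makes it
   positive. *)
exists (C1 + a * C2 + 1); first by rewrite ltr_wpDl // addr_ge0 // mulr_ge0.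
move=> I d T x B k kB.
have [_ _ /le_trans] := costs_select_step x a0 (lin #|B|) (leqnSn _) (leqnn _) kB.
by apply; rewrite lerD2l ler_wpM2r ?f_ge0 // lerDl.
Qed.

End Induction.

Theorem theorem1 (R : realType) (alpha r beta : R)
    (halpha : 0 < alpha <= 1 / 2) (hr : 1 < r)
    (hbeta : 1 / 4 * (1 - r^-1) ^- 2 <= beta) :
  exists2 gamma : R, 0 < gamma &
    forall (n k : nat) (d : Order.disp_t) (T : orderType d) (x : 'I_n -> T),
      (1 <= n)%N -> (1 <= k <= n)%N ->
      expected_comparisons (select alpha r beta x [set: 'I_n] k)
        <= n%:R + (minn k (n - k))%:R + gamma * f (n%:R : R).
Proof.
have [gamma gamma0 bound] := expected_select halpha hr hbeta.
exists gamma => // n k d T x _ kn.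
by have := bound _ d T x [set: 'I_n] k; rewrite cardsT card_ord; apply.
Qed.
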